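(* Let $\mathcal{H}_S,\mathcal{H}_E$ be finite-dimensional Hilbert spaces and $\mathcal{S}$ a nonempty set of density operators on $\mathcal{H}_S\otimes\mathcal{H}_E$. Let $\mathcal{S}'=\{\rho_{SE}^{(1)},\dots,\rho_{SE}^{(M)}\}\subseteq\mathcal{S}$ be a maximal linearly independent subset of $\mathcal{S}$, ordered so that for some $m\le M$ the reduced states $\rho_S^{(i)}=\mathrm{Tr}_E(\rho_{SE}^{(i)})$, $i=1,\dots,m$, are linearly independent and span $\mathcal{V}_S:=\mathrm{Tr}_E\mathcal{V}$, where $\mathcal{V}=\mathrm{Span}_{\mathbb{C}}\mathcal{S}$. Let $\hat{\mathcal{V}}=\mathrm{Span}_{\mathbb{C}}\{\rho_{SE}^{(1)},\dots,\rho_{SE}^{(m)}\}$. Let $\mathcal{G}$ be the set of unitaries $U$ on $\mathcal{H}_S\otimes\mathcal{H}_E$ such that $\mathcal{V}$ is $U$-consistent, i.e. for all $X,Y\in\mathcal{V}$ with $\mathrm{Tr}_EX=\mathrm{Tr}_EY$ one has $\mathrm{Tr}_E(UXU^\dagger)=\mathrm{Tr}_E(UYU^\dagger)$. Define the reference state $$\omega_{RSE}=\sum_{l=1}^m\frac1m\,|l_R\rangle\langle l_R|\otimes\rho_{SE}^{(l)},$$ with $\{|l_R\rangle\}_{l=1}^m$ an orthonormal basis of an auxiliary Hilbert space $\mathcal{H}_R$. Suppose there exists a linear, trace-preserving, positive map $\Lambda_S^{(P)}:\mathcal{L}(\mathcal{H}_S)\to\mathcal{L}(\mathcal{H}_S\otimes\mathcal{H}_E)$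 mapping $\mathcal{V}_S$ to $\hat{\mathcal{V}}$, i.e. $\Lambda_S^{(P)}(\rho_S^{(i)})=\rho_{SE}^{(i)}$ for $i=1,\dots,m$. Then: (i) $\omega_{RSE}$ is a Markov state; (ii) there exists a linear, trace-preserving, completely positive map $\Lambda_S^{(CP)}:\mathcal{L}(\mathcal{H}_S)\to\mathcal{L}(\mathcal{H}_S\otimes\mathcal{H}_E)$ with $\Lambda_S^{(CP)}(\rho_S^{(i)})=\rho_{SE}^{(i)}$ for $i=1,\dots,m$; (iii) $\mathrm{Tr}_E(\mathcal{D}(\mathcal{H}_S\otimes\mathcal{H}_E)\cap\mathcal{V})=\mathcal{D}(\mathcal{H}_S)\cap\mathcal{V}_S$, and for every $U\in\mathcal{G}$ the map $\mathcal{E}_S=\mathrm{Tr}_E\circ\mathrm{Ad}_U\circ\Lambda_S^{(CP)}$ (with $\mathrm{Ad}_U(X)=UXU^\dagger$) is completely positive and satisfies $\mathcal{E}_S(\mathrm{Tr}_E\rho_{SE})=\mathrm{Tr}_E(U\rho_{SE}U^\dagger)$ for every $\rho_{SE}\in\mathcal{D}(\mathcal{H}_S\otimes\mathcal{H}_E)\cap\mathcal{V}$.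
   Context: $\mathcal{L}(\mathcal{H})$ denotes the linear operators on $\mathcal{H}$ and $\mathcal{D}(\mathcal{H})$ the density operators. A positive map sends positive semidefinite operators to positive semidefinite operators; completely positive means $\mathrm{id}_k\otimes\Phi$ is positive for all $k$. A tripartite state $\sigma_{RSE}$ is a Markov state if there is a decomposition $\mathcal{H}_S=\bigoplus_k\mathcal{H}_{s_k^L}\otimes\mathcal{H}_{s_k^R}$ (orthogonal direct sum) such that $\sigma_{RSE}=\bigoplus_k\lambda_k\,\sigma_{Rs_k^L}\otimes\sigma_{s_k^RE}$ with $\{\lambda_k\}$ a probability distribution, $\sigma_{Rs_k^L}\in\mathcal{D}(\mathcal{H}_R\otimes\mathcal{H}_{s_k^L})$ and $\sigma_{s_k^RE}\in\mathcal{D}(\mathcal{H}_{s_k^R}\otimes\mathcal{H}_E)$. *)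

(* Defs.v *)
From HB Require Import structures.
From mathcomp Require Import all_boot all_order all_algebra.
From mathcomp Require Import reals.
From mathcomp Require Import complex mxtens.
Set Implicit Arguments.
Unset Strict Implicit.
Unset Printing Implicit Defensive.
Import Order.TTheory GRing.Theory Num.Theory.
Local Open Scope ring_scope.

Section QDefs.
Variable R : realType.
Local Notation C := R[i].

Definition adjmx m n (A : 'M[C]_(m, n)) : 'M[C]_(n, m) := map_mx Num.conj A^T.

Definition psd n (A : 'M[C]_n) : Prop :=
  forall v : 'cV[C]_n, 0 <= (adjmx v *m A *m v) 0 0.

Definition density n (A : 'M[C]_n) : Prop := psd A /\ \tr A = 1.

Definition unitary n (U : 'M[C]_n) : Prop := U *m adjmx U = 1%:M.

Definition ptrE dS dE (X : 'M[C]_(dS * dE)) : 'M[C]_dS :=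
  \matrix_(i, j) \sum_(e < dE) X (mxtens_index (i, e)) (mxtens_index (j, e)).

Definition positive_map n p (f : 'M[C]_n -> 'M[C]_p) : Prop :=
  forall X, psd X -> psd (f X).

(* id_k (x) f acting on L(C^k (x) C^n) *)
Definition ampl k n p (f : 'M[C]_n -> 'M[C]_p) (X : 'M[C]_(k * n)) : 'M[C]_(k * p) :=
  \sum_(a < k) \sum_(b < k)
     (delta_mx a b *t f (\matrix_(i, j) X (mxtens_index (a, i)) (mxtens_index (b, j)))).

Definition completely_positive n p (f : 'M[C]_n -> 'M[C]_p) : Prop :=
  forall k : nat, positive_map (@ampl k n p f).

Definition trace_preserving n p (f : 'M[C]_n -> 'M[C]_p) : Prop :=
  forall X, \tr (f X) = \tr X.

Definition inSpanSet n (S : 'M[C]_n -> Prop) (X : 'M[C]_n) : Prop :=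
  exists s : seq 'M[C]_n, (forall Y, Y \in s -> S Y) /\ X \in <<s>>%VS.

Definition ptrE_set dS dE (V : 'M[C]_(dS * dE) -> Prop) (Y : 'M[C]_dS) : Prop :=
  exists X, V X /\ Y = ptrE X.

Definition U_consistent dS dE (V : 'M[C]_(dS * dE) -> Prop) (U : 'M[C]_(dS * dE)) :=
  forall X Y, V X -> V Y -> ptrE X = ptrE Y ->
    ptrE (U *m X *m adjmx U) = ptrE (U *m Y *m adjmx U).

Lemma tens_assoc_eq (a b c d : nat) : ((a * b) * (c * d) = a * ((b * c) * d))%N.
Proof. by rewrite !mulnA. Qed.

(* Markov state on H_R (x) H_S (x) H_E with dims dR, dS, dE.
   H_S = orthogonal direct sum over k of ranges of isometries
   J k : C^(aL k) (x) C^(aR k) -> H_S. *)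
Definition markov_state dR dS dE (w : 'M[C]_(dR * (dS * dE))) : Prop :=
  exists (K : nat) (aL aR : 'I_K -> nat)
         (J : forall k : 'I_K, 'M[C]_(dS, aL k * aR k))
         (lam : 'I_K -> C)
         (sRL : forall k : 'I_K, 'M[C]_(dR * aL k))
         (sRE : forall k : 'I_K, 'M[C]_(aR k * dE)),
    [/\ (forall k, adjmx (J k) *m J k = 1%:M) /\
          (forall k l, k != l -> adjmx (J k) *m J l = 0),
        \sum_(k < K) J k *m adjmx (J k) = 1%:M,
        ((forall k, 0 <= lam k) /\ \sum_(k < K) lam k = 1),
        (forall k, density (sRL k) /\ density (sRE k)) &
        w = \sum_(k < K) lam k *:
              (((1%:M : 'M[C]_dR) *t (J k *t (1%:M : 'M[C]_dE)))
               *m castmx (tens_assoc_eq dR (aL k) (aR k) dE,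
                          tens_assoc_eq dR (aL k) (aR k) dE) (sRL k *t sRE k)
               *m adjmx ((1%:M : 'M[C]_dR) *t (J k *t (1%:M : 'M[C]_dE))))].

Definition omega_ref dS dE (m : nat) (rho : nat -> 'M[C]_(dS * dE)) : 'M[C]_(m * (dS * dE)) :=
  \sum_(l < m) (m%:R)^-1 *: (delta_mx l l *t rho l).

End QDefs.

(* Main.v *)
(* Let w be the average of the states rho_i and w_S its reduction.  For a positive
   trace-preserving map T, conjugating T by fourth roots of w and T w gives a map F
   with F (sqrt w) = sqrt (T w) and F^* (sqrt (T w)) <= sqrt w, which contracts the
   Hilbert-Schmidt norm.  Applied to Tr_E and to the assignment map, this shows that
   Tr_E preserves the norm of the rescaled rho_i, so F^* F fixes them: that is, the
   Petz map recovers rho_i = G (D_i (x) 1) G with G = sqrt w,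
   D_i = w_S^(-1/2) Tr_E rho_i w_S^(-1/2).  The Petz map is completely positive.

   The matrices D commuting with the support of w_S and satisfying
   Tr_E (G (D (x) 1) G) = w_S^(1/2) D w_S^(1/2) form a *-algebra A, because the
   condition forces (D (x) 1) G = G (w_S^(-1/2) D w_S^(1/2) (x) 1).  It contains the D_i
   and is stable under the modular maps, so rho_i = (E_i (x) 1) w with E_i in A.  Minimal
   projections of A, linked by partial isometries of A, decompose H_S; since a corner
   p A p is one-dimensional, each block of rho_i is a scalar multiple of
   (p (x) 1) w (p (x) 1), which is the Markov structure. *)
Require Import Defs.
From HB Require Import structures.
From mathcomp Require Import all_boot all_order all_algebra.
From mathcomp Require Import boolp reals.
From mathcomp Require Import complex mxtens.
Set Implicit Arguments.
Unset Strict Implicit.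
Unset Printing Implicit Defensive.
Import Order.TTheory GRing.Theory Num.Theory.
Local Open Scope ring_scope.

(** [LP] is only positive, so the equality case of a Schwarz inequality, which would ask for
    2-positivity, is out of reach. What positivity does preserve is the operator order, and the norm
    contraction is drawn from the order alone: the uniform average gives [rho i <= m w], and this
    bound survives every iterate of the self-dual map built from F and its dual. Fourth roots put
    half of each square root on either side of the argument, which keeps both maps positive.

    Neither w nor w_S need be invertible. Hence the Moore-Penrose inverses, the support [P] that
    follows them everywhere, and a second term in the completely positive map, which restores the
    trace lost off the support. Elements of A merely commute with [P], so that A contains 1 and its
    projections decompose all of H_S.

    Moving [y] (x) 1 across w turns [y] into w_S [y] w_S^(-1), which destroys orthogonality of
    projections. Comparing a minimal projection with its image under this map is the delicate point
    of the block computation. *)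

Local Notation "A ^H" := (adjmx A) (at level 8, format "A ^H").

(** * Positive semidefinite matrices *)

Section Adjoint.
Variable R : realType.
Local Notation C := R[i].

Lemma adjmxE m n (A : 'M[C]_(m, n)) i j : A^H i j = (A j i)^*.
Proof. by rewrite !mxE. Qed.

Lemma adjmxK m n (A : 'M[C]_(m, n)) : A^H^H = A.
Proof. by apply/matrixP=> i j; rewrite !adjmxE conjCK. Qed.

Lemma adjmxM m n p (A : 'M[C]_(m, n)) (B : 'M[C]_(n, p)) :
  (A *m B)^H = B^H *m A^H.
Proof. by rewrite /adjmx trmx_mul map_mxM. Qed.

Lemma adjmxD m n (A B : 'M[C]_(m, n)) : (A + B)^H = A^H + B^H.
Proof. by apply/matrixP=> i j; rewrite !mxE rmorphD. Qed.

Lemma adjmxN m n (A : 'M[C]_(m, n)) : (- A)^H = - A^H.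
Proof. by apply/matrixP=> i j; rewrite !mxE rmorphN. Qed.

Lemma adjmxB m n (A B : 'M[C]_(m, n)) : (A - B)^H = A^H - B^H.
Proof. by rewrite adjmxD adjmxN. Qed.

Lemma adjmxZ m n a (A : 'M[C]_(m, n)) : (a *: A)^H = a^* *: A^H.
Proof. by apply/matrixP=> i j; rewrite !mxE rmorphM. Qed.

Lemma adjmx0 m n : (0 : 'M[C]_(m, n))^H = 0.
Proof. by apply/matrixP=> i j; rewrite !mxE rmorph0. Qed.

Lemma adjmx1 n : (1%:M : 'M[C]_n)^H = 1%:M.
Proof. by apply/matrixP=> i j; rewrite !mxE eq_sym rmorphMn rmorph1. Qed.

Lemma adjmx_delta m n (i : 'I_m) (j : 'I_n) :
  (delta_mx i j : 'M[C]_(m, n))^H = delta_mx j i.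
Proof.
by apply/matrixP=> k l; rewrite !mxE andbC; case: (_ && _); rewrite ?rmorph1 ?rmorph0.
Qed.

Lemma adjmx_sum m n (I : finType) (F : I -> 'M[C]_(m, n)) :
  (\sum_i F i)^H = \sum_i (F i)^H.
Proof. by apply: (big_morph _ (@adjmxD m n) (@adjmx0 m n)). Qed.

Lemma adjmx_tens m n p q (A : 'M[C]_(m, n)) (B : 'M[C]_(p, q)) :
  (A *t B)^H = A^H *t B^H.
Proof. by rewrite /adjmx trmx_tens map_mxT. Qed.

Lemma mxtrace_gram m n (A : 'M[C]_(m, n)) :
  \tr (A^H *m A) = \sum_i \sum_j `|A j i| ^+ 2.
Proof.
apply: eq_bigr => i _; rewrite mxE; apply: eq_bigr => j _.
by rewrite adjmxE mulrC -normCK.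
Qed.

Lemma mxtrace_gram_ge0 m n (A : 'M[C]_(m, n)) : 0 <= \tr (A^H *m A).
Proof.
by rewrite mxtrace_gram; apply: sumr_ge0 => i _; apply: sumr_ge0 => j _; rewrite exprn_ge0.
Qed.

Lemma mxtrace_gram_le0 m n (A : 'M[C]_(m, n)) : \tr (A^H *m A) <= 0 -> A = 0.
Proof.
move=> le0; apply/matrixP=> j i; rewrite mxE.
have /eqP : \tr (A^H *m A) = 0 by apply/le_anti; rewrite le0 mxtrace_gram_ge0.
rewrite mxtrace_gram psumr_eq0 => [|k _]; last by apply: sumr_ge0 => l _; rewrite exprn_ge0.
move=> /allP/(_ i (mem_index_enum _))/=.
rewrite psumr_eq0 => [|k _]; last by rewrite exprn_ge0.
by move=> /allP/(_ j (mem_index_enum _))/=; rewrite sqrf_eq0 normr_eq0 => /eqP.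
Qed.

End Adjoint.

Section Psd.
Variable R : realType.
Local Notation C := R[i].

(** Polarization: [u + w] makes the form antisymmetric, and [u + 'i *: w] then makes it vanish. *)
Lemma quadratic_form_eq0 n (B : 'M[C]_n) :
  (forall v : 'cV[C]_n, v^H *m B *m v = 0) -> B = 0.
Proof.
move=> qB; have bB (u w : 'cV[C]_n) : u^H *m B *m w = 0.
  have e1 : w^H *m B *m u = - (u^H *m B *m w).
    apply/eqP; rewrite -addr_eq0; apply/eqP.
    by have := qB (u + w); rewrite adjmxD !(mulmxDl, mulmxDr) !qB add0r addr0.
  have := qB (u + 'i *: w).
  rewrite adjmxD adjmxZ !(mulmxDl, mulmxDr) -!(scalemxAl, scalemxAr).
  rewrite !qB !scaler0 add0r addr0 conjCi e1 scaleNr scalerN opprK -scalerDl.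
  move/eqP; rewrite scaler_eq0 -mulr2n mulrn_eq0 (negPf (neq0Ci _)) /=.
  by move/eqP.
apply/matrixP=> i j; have := bB (delta_mx i 0) (delta_mx j 0).
by rewrite adjmx_delta -rowE -colE => /matrixP/(_ 0 0); rewrite !mxE.
Qed.

Lemma psd_adj n (A : 'M[C]_n) : psd A -> A^H = A.
Proof.
move=> pA; apply/esym/subr0_eq/quadratic_form_eq0 => v.
apply/matrixP=> i j; rewrite !ord1 mulmxBr mulmxBl [LHS]mxE [X in _ + X]mxE [RHS]mxE.
have -> : v^H *m A^H *m v = (v^H *m A *m v)^H by rewrite !adjmxM adjmxK mulmxA.
by rewrite adjmxE (conj_Creal (ger0_real (pA v))) addrN.
Qed.

Lemma psdD n (A B : 'M[C]_n) : psd A -> psd B -> psd (A + B).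
Proof. by move=> pA pB v; rewrite mulmxDr mulmxDl mxE addr_ge0. Qed.

Lemma psd0 n : psd (0 : 'M[C]_n).
Proof. by move=> v; rewrite mulmx0 mul0mx mxE. Qed.

Lemma psdZ n a (A : 'M[C]_n) : 0 <= a -> psd A -> psd (a *: A).
Proof. by move=> a0 pA v; rewrite -scalemxAr -scalemxAl mxE mulr_ge0. Qed.

Lemma psd_sum n (I : finType) (P : pred I) (F : I -> 'M[C]_n) :
  (forall i, P i -> psd (F i)) -> psd (\sum_(i | P i) F i).
Proof. by move=> pF; apply: (big_ind (@psd R n)); [apply: psd0|apply: psdD|]. Qed.

Lemma psd_conj m n (K : 'M[C]_(n, m)) (A : 'M[C]_n) :
  psd A -> psd (K^H *m A *m K).
Proof. by move=> pA v; have := pA (K *m v); rewrite adjmxM !mulmxA. Qed.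

Lemma psd_conjr m n (K : 'M[C]_(m, n)) (A : 'M[C]_n) :
  psd A -> psd (K *m A *m K^H).
Proof. by move=> pA; rewrite -{1}[K]adjmxK; apply: psd_conj. Qed.

Lemma psd1 n : psd (1%:M : 'M[C]_n).
Proof.
by move=> v; rewrite mulmx1; have := mxtrace_gram_ge0 v; rewrite /mxtrace big_ord1.
Qed.

Lemma psd_gram m n (K : 'M[C]_(m, n)) : psd (K^H *m K).
Proof. by have := psd_conj K (@psd1 m); rewrite mulmx1. Qed.

Lemma psd_tr_ge0 n (A : 'M[C]_n) : psd A -> 0 <= \tr A.
Proof.
move=> pA; apply: sumr_ge0 => i _; have := pA (delta_mx i 0).
by rewrite adjmx_delta -rowE -colE !mxE.
Qed.

Lemma hermitian_spectral n (A : 'M[C]_n) : A^H = A ->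
  exists (U : 'M[C]_n) (d : 'rV[C]_n),
    [/\ U *m U^H = 1%:M, U^H *m U = 1%:M & A = U^H *m diag_mx d *m U].
Proof.
move=> hA; have UU : spectralmx A *m (spectralmx A)^H = 1%:M.
  exact/unitarymxP/spectral_unitarymx.
have UU' := mulmx1C UU.
exists (spectralmx A), (spectral_diag A); split => //.
have nA : A \is normalmx.
  by apply/normalmxP; rewrite -/(adjmx A) hA.
rewrite {1}(orthomx_spectralP nA); congr (_ *m _ *m _).
exact: (invmx_unitary (spectral_unitarymx A)).
Qed.

Lemma psd_spectral n (A : 'M[C]_n) : psd A ->
  exists (U : 'M[C]_n) (d : 'rV[C]_n),
    [/\ U *m U^H = 1%:M, U^H *m U = 1%:M, A = U^H *m diag_mx d *m U &
        forall i, 0 <= d 0 i].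
Proof.
move=> pA; have [U [d [UU' U'U eA]]] := hermitian_spectral (psd_adj pA).
exists U, d; split=> // i; have := pA (U^H *m delta_mx i 0).
rewrite eA adjmxM adjmxK adjmx_delta !mulmxA -(mulmxA _ U) UU' mulmx1.
by rewrite -(mulmxA _ U) UU' mulmx1 -rowE -colE !mxE eqxx.
Qed.

Lemma conj_diag_mul n (U : 'M[C]_n) (d e : 'rV[C]_n) : U *m U^H = 1%:M ->
  (U^H *m diag_mx d *m U) *m (U^H *m diag_mx e *m U) =
  U^H *m diag_mx (\row_i (d 0 i * e 0 i)) *m U.
Proof.
move=> UU; rewrite !mulmxA -(mulmxA _ U) UU mulmx1 -(mulmxA U^H).
by rewrite mulmx_diag.
Qed.

Lemma psd_conj_diag n (U : 'M[C]_n) (d : 'rV[C]_n) :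
  (forall i, 0 <= d 0 i) -> psd (U^H *m diag_mx d *m U).
Proof.
move=> d0; apply: psd_conj => v; rewrite -mulmxA mxE; apply: sumr_ge0 => i _.
by rewrite mul_diag_mx mxE adjmxE mulrCA mulrC -normCKC mulr_ge0 ?exprn_ge0.
Qed.

(* [qi] is the Moore-Penrose inverse of the fourth root [q] of [W], so that
   [q *m qi] is the support projection of [W]. *)
Definition quarter_root n (W q qi : 'M[C]_n) :=
  [/\ psd q, psd qi, q *m q *m (q *m q) = W, q *m qi = qi *m q &
      (q *m qi *m q = q) /\ (qi *m q *m qi = qi)].

(* On the spectrum [qi] is the inverse of [q], with [0^-1 = 0]. *)
Lemma psd_quarter n (W : 'M[C]_n) : psd W -> exists q qi, quarter_root W q qi.
Proof.
move=> /psd_spectral[U [d [UU _ eW d0]]].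
pose s i := sqrtC (sqrtC (d 0 i)).
have s0 i : 0 <= s i by rewrite !sqrtC_ge0.
pose fc (e : 'rV[C]_n) := U^H *m diag_mx e *m U.
have fcM e f : fc e *m fc f = fc (\row_i (e 0 i * f 0 i)) by apply: conj_diag_mul.
have fc0 (e : 'rV[C]_n) : (forall i, 0 <= e 0 i) -> psd (fc e) by apply: psd_conj_diag.
rewrite -/(fc d) in eW; move: fcM fc0 eW; move: fc => fc fcM fc0 ->.
exists (fc (\row_i s i)), (fc (\row_i (s i)^-1)); rewrite /quarter_root !fcM; split.
- by apply: fc0 => i; rewrite mxE.
- by apply: fc0 => i; rewrite mxE invr_ge0.
- by congr fc; apply/rowP=> i; rewrite !mxE /s -!expr2 !sqrtCK.
- by congr fc; apply/rowP=> i; rewrite !mxE mulrC.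
- split; congr fc; apply/rowP=> i; rewrite !mxE.
    by have [->|n0] := eqVneq (s i) 0; [rewrite mulr0 | rewrite mulfV // mul1r].
  by have [->|n0] := eqVneq (s i) 0; [rewrite invr0 mulr0 | rewrite mulVf // mul1r].
Qed.

Lemma psd_sqrt n (A : 'M[C]_n) : psd A -> exists r : 'M[C]_n, psd r /\ r *m r = A.
Proof.
move=> /psd_quarter[q [_ [pq _ eA _ _]]]; exists (q *m q); split => //.
by rewrite -{1}(psd_adj pq); apply: psd_gram.
Qed.

Lemma psd_tr_le0 n (A : 'M[C]_n) : psd A -> \tr A <= 0 -> A = 0.
Proof.
move=> /psd_sqrt[r [/psd_adj hr <-]]; rewrite -{1}hr => /mxtrace_gram_le0 ->.
by rewrite mul0mx.
Qed.

Lemma psd_trM_ge0 n (A B : 'M[C]_n) : psd A -> psd B -> 0 <= \tr (A *m B).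
Proof.
move=> pA /psd_sqrt[r [/psd_adj hr <-]]; rewrite mulmxA mxtrace_mulC mulmxA -{1}hr.
by apply/psd_tr_ge0/psd_conj.
Qed.

(** Compressing to [Q] squeezes [Q^H *m A *m Q] between 0 and 0, so the square root of [A] already
    kills [Q]. *)
Lemma psd_dominated_ker n p c (A B : 'M[C]_n) (Q : 'M[C]_(n, p)) :
  psd A -> psd (c *: B - A) -> B *m Q = 0 -> A *m Q = 0.
Proof.
move=> /psd_sqrt[r [/psd_adj hr eA]] pBA BQ.
have := psd_tr_ge0 (psd_conj Q pBA).
rewrite mulmxBr mulmxBl -scalemxAr -scalemxAl -(mulmxA _ B) BQ mulmx0 scaler0 sub0r.
rewrite raddfN oppr_ge0 -eA => le0; rewrite -mulmxA.
rewrite (@mxtrace_gram_le0 _ _ _ (r *m Q)) ?mulmx0 //.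
by rewrite adjmxM hr !mulmxA in le0 *.
Qed.

Lemma psd_normalize_density n (A : 'M[C]_n) : psd A -> \tr A != 0 ->
  density ((\tr A)^-1 *: A).
Proof.
move=> pA n0; split; first by apply: psdZ => //; rewrite invr_ge0 psd_tr_ge0.
by rewrite mxtraceZ mulVf.
Qed.

End Psd.

(** * Positive maps and trace duality *)

Section MxTrace.
Variable K : comPzRingType.

Lemma mxtraceB n (A B : 'M[K]_n) : \tr (A - B) = \tr A - \tr B.
Proof. by rewrite raddfB. Qed.

Lemma mxtrace_sqr_lincomb n (A B : 'M[K]_n) x y :
  \tr ((x *: B - y *: A) *m (x *: B - y *: A)) =
  x ^+ 2 * \tr (B *m B) - x * y * \tr (A *m B) *+ 2 + y ^+ 2 * \tr (A *m A).
Proof.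
rewrite mulmxBl !mulmxBr -!scalemxAl -!scalemxAr !mxtraceB !mxtraceZ.
rewrite (mxtrace_mulC B A) (mulrCA y x) !mulrA -!expr2 opprB mulr2n opprD.
by rewrite !addrA addrAC.
Qed.

Lemma mxtrace_sqrB n (A B : 'M[K]_n) :
  \tr ((A - B) *m (A - B)) = \tr (A *m A) - \tr (A *m B) *+ 2 + \tr (B *m B).
Proof.
rewrite -[A]scale1r -[B]scale1r mxtrace_sqr_lincomb !scale1r expr1n !mul1r.
by rewrite (mxtrace_mulC B A).
Qed.

Lemma mulmx_conj_lincomb m n p (P : 'M[K]_(m, n)) (Q : 'M[K]_(n, p)) A B x :
  P *m (x *: A - B) *m Q = x *: (P *m A *m Q) - P *m B *m Q.
Proof. by rewrite mulmxBr mulmxBl -scalemxAr -scalemxAl. Qed.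

End MxTrace.

Section LinearMaps.
Variable R : realType.
Local Notation C := R[i].
Variables (m n p q : nat) (f : 'M[C]_(m, n) -> 'M[C]_(p, q)).
Hypothesis lin_f : linear f.

Lemma linear_f0 : f 0 = 0.
Proof. by have := lin_f (-1) 0 0; rewrite scaler0 addr0 scaleN1r addNr. Qed.

Lemma linear_fD X Y : f (X + Y) = f X + f Y.
Proof. by have := lin_f 1 X Y; rewrite !scale1r. Qed.

Lemma linear_fZ a X : f (a *: X) = a *: f X.
Proof. by have := lin_f a X 0; rewrite addr0 linear_f0 addr0. Qed.

Lemma linear_fB X Y : f (X - Y) = f X - f Y.
Proof. by rewrite -scaleN1r linear_fD linear_fZ scaleN1r. Qed.

Lemma linear_fsum (I : Type) (r : seq I) (P : pred I) (F : I -> 'M[C]_(m, n)) :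
  f (\sum_(i <- r | P i) F i) = \sum_(i <- r | P i) f (F i).
Proof. exact: (big_morph f linear_fD linear_f0). Qed.

End LinearMaps.

Section TraceDual.
Variable R : realType.
Local Notation C := R[i].

Lemma mxtrace_delta_mul n (i j : 'I_n) (A : 'M[C]_n) :
  \tr (A *m delta_mx i j) = A j i.
Proof.
rewrite mxtrace_mulC /mxtrace (bigD1 i) //= big1 ?addr0.
  rewrite mxE (bigD1 j) //= big1 ?addr0 => [|k /negPf nk].
    by rewrite mxE !eqxx mul1r.
  by rewrite mxE nk andbF mul0r.
by move=> k /negPf nk; rewrite mxE big1 // => l _; rewrite mxE nk mul0r.
Qed.

Lemma mxtrace_mul_inj n (A B : 'M[C]_n) :
  (forall X, \tr (A *m X) = \tr (B *m X)) -> A = B.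
Proof.
by move=> eAB; apply/matrixP=> i j; have := eAB (delta_mx j i); rewrite !mxtrace_delta_mul.
Qed.

(** The pairing is the bilinear [\tr (A *m B)], without conjugation, so the dual is linear; on
    positive linear maps it agrees with the Hilbert-Schmidt adjoint. *)
Definition trdual n p (f : 'M[C]_n -> 'M[C]_p) (A : 'M[C]_p) : 'M[C]_n :=
  \matrix_(i, j) \tr (A *m f (delta_mx j i)).

Lemma trdualE n p (f : 'M[C]_n -> 'M[C]_p) A B : linear f ->
  \tr (trdual f A *m B) = \tr (A *m f B).
Proof.
move=> lf; rewrite [in RHS](matrix_sum_delta B) (linear_fsum lf) mulmx_sumr raddf_sum /=.
rewrite mxtrace_mulC; apply: eq_bigr => i _.
rewrite mxE (linear_fsum lf) mulmx_sumr raddf_sum /=; apply: eq_bigr => j _.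
by rewrite (linear_fZ lf) -scalemxAr mxtraceZ mxE.
Qed.

Lemma trdual_linear n p (f : 'M[C]_n -> 'M[C]_p) : linear (trdual f).
Proof.
by move=> a A B; apply/matrixP=> i j; rewrite !mxE mulmxDl -scalemxAl mxtraceD mxtraceZ.
Qed.

Lemma trdual_positive n p (f : 'M[C]_n -> 'M[C]_p) :
  linear f -> positive_map f -> positive_map (trdual f).
Proof.
move=> lf pf A pA v.
have -> : (v^H *m trdual f A *m v) 0 0 = \tr (trdual f A *m (v *m v^H)).
  by rewrite mulmxA [RHS]mxtrace_mulC mulmxA /mxtrace big_ord1.
rewrite trdualE //; apply: psd_trM_ge0 => //; apply: pf.
by have := psd_gram v^H; rewrite adjmxK.
Qed.

Lemma trdual1 n p (f : 'M[C]_n -> 'M[C]_p) :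
  linear f -> trace_preserving f -> trdual f 1%:M = 1%:M.
Proof.
by move=> lf tf; apply: mxtrace_mul_inj => X; rewrite trdualE // !mul1mx tf.
Qed.

End TraceDual.

(** * Contraction of the Hilbert-Schmidt norm *)

Section Contraction.
Variable R : realType.
Local Notation C := R[i].

(** Log-convexity makes the ratios of successive terms nondecreasing. A first ratio above 1 would
    force geometric growth, and Bernoulli's linear lower bound for it already contradicts [B]. *)
Lemma bounded_log_convex (a : nat -> R) B :
  (forall k, 0 <= a k) -> (forall k, a k <= B) ->
  (forall k, a k.+1 ^+ 2 <= a k * a k.+2) -> a 1%N <= a 0%N.
Proof.
move=> a0 aB lc; rewrite leNgt; apply/negP=> lt01.
have a00 : 0 < a 0%N.
  rewrite lt_neqAle a0 andbT eq_sym; apply/eqP=> e0.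
  have := lc 0%N; rewrite e0 mul0r leNgt => /negP; apply.
  by rewrite exprn_gt0 // -e0.
pose r := a 1%N / a 0%N.
have r1 : 1 < r by rewrite ltr_pdivlMr // mul1r.
have step k : 0 < a k /\ r * a k <= a k.+1.
  elim: k => [|k [ak IH]]; first by rewrite divfK ?gt_eqF.
  have ak1 : 0 < a k.+1 by apply: lt_le_trans IH; rewrite mulr_gt0 // (lt_trans ltr01).
  split=> //; rewrite -(ler_pM2l ak) (le_trans _ (lc k)) // expr2 mulrA.
  by rewrite ler_pM2r // mulrC.
have geo k : a 0%N * (1 + (r - 1) *+ k) <= a k.
  elim: k => [|k IH]; first by rewrite addr0 mulr1.
  have [ak rak] := step k; apply: le_trans rak.
  have -> : r * a k = a k + a k * (r - 1) by rewrite mulrBr mulr1 addrC subrK mulrC.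
  rewrite mulrSr addrA mulrDr; apply: lerD => //.
  rewrite ler_wpM2r ?subr_ge0 ?(ltW r1) //; apply: le_trans IH.
  by rewrite ler_peMr ?(ltW a00) // lerDl mulrn_wge0 // subr_ge0 ltW.
have d0 : 0 < a 0%N * (r - 1) by rewrite mulr_gt0 // subr_gt0.
have := archi_boundP (divr_ge0 (le_trans (a0 0%N) (aB 0%N)) (ltW d0)).
set k := Num.bound _; rewrite ltr_pdivrMr // => ltB.
have := le_trans (geo k) (aB k); rewrite leNgt => /negP; apply.
by apply: lt_le_trans ltB _; rewrite [leRHS]mulrDr mulr1 -[X in _ + _ * X]mulr_natl [X in _ <= _ + X]mulrCA lerDr ltW.
Qed.

(** The usual quadratic argument: the norm of [al *: B - ga *: A] is nonnegative and equals [al]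
    times the defect. *)
Lemma mxtrace_CauchySchwarz n (A B : 'M[C]_n) : psd A -> psd B ->
  \tr (A *m B) ^+ 2 <= \tr (A *m A) * \tr (B *m B).
Proof.
move=> pA pB.
have [al eal] : exists x : C, x = \tr (A *m A) by exists (\tr (A *m A)).
have [be ebe] : exists x : C, x = \tr (B *m B) by exists (\tr (B *m B)).
have [ga ega] : exists x : C, x = \tr (A *m B) by exists (\tr (A *m B)).
have al0 : 0 <= al by rewrite eal; apply: psd_trM_ge0.
have ga0 : 0 <= ga by rewrite ega; apply: psd_trM_ge0.
have [al00|nal] := eqVneq al 0.
  suff A0 : A = 0 by rewrite A0 !mul0mx mxtrace0 expr2 !mul0r.
  by apply: mxtrace_gram_le0; rewrite psd_adj // -eal al00.
have := mxtrace_gram_ge0 (al *: B - ga *: A).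
rewrite adjmxB !adjmxZ (psd_adj pA) (psd_adj pB) !conj_Creal ?ger0_real //.
rewrite mxtrace_sqr_lincomb -ega -eal -ebe.
have -> : al ^+ 2 * be - al * ga * ga *+ 2 + ga ^+ 2 * al = al * (al * be - ga ^+ 2).
  rewrite mulrBr mulrA -expr2 -addrA; congr (_ + _).
  by rewrite -mulrA -expr2 (mulrC (ga ^+ 2)) mulr2n opprD subrK.
by rewrite pmulr_rge0 ?subr_ge0 // lt_neqAle eq_sym nal.
Qed.

(* [\tr ((L^k X)^2)] is log-convex in [k] and bounded, hence nonincreasing. *)
Lemma selfdual_contraction n (L : 'M[C]_n -> 'M[C]_n) (h X : 'M[C]_n) c :
  linear L -> (forall A B, \tr (L A *m B) = \tr (A *m L B)) -> positive_map L ->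
  psd h -> psd (h - L h) -> 0 <= c -> psd X -> psd (c *: h - X) ->
  \tr (L X *m L X) <= \tr (X *m X).
Proof.
move=> lL dL pL ph pLh c0 pX pcX.
have [Y [Y0 YS]] : exists Y, Y 0%N = X /\ forall k, Y k.+1 = L (Y k).
  by exists (fun k => iter k L X).
have pY k : psd (Y k) by elim: k => [|k IH]; [rewrite Y0 | rewrite YS; apply: pL].
(* The bound by [c *: h] is stable under [L] because [L h <= h]. *)
have bY k : psd (c *: h - Y k).
  elim: k => [|k IH]; first by rewrite Y0.
  have -> : c *: h - Y k.+1 = c *: (h - L h) + L (c *: h - Y k).
    by rewrite (linear_fB lL) (linear_fZ lL) scalerBr addrA subrK YS.
  by apply: psdD; [apply: psdZ | apply: pL].
have [a ea] : exists a : nat -> C, forall k, a k = \tr (Y k *m Y k).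
  by exists (fun k => \tr (Y k *m Y k)).
have a0 k : 0 <= a k by rewrite ea; exact: (psd_trM_ge0 (pY k) (pY k)).
have [B eB] : exists B : C, B = \tr (c *: h *m (c *: h)).
  by exists (\tr (c *: h *m (c *: h))).
(* [B - a k] is the sum of the traces of [(c *: h - Y k) *m Y k] and [c *: h *m (c *: h - Y k)],
   both products of positive matrices. *)
have aB k : a k <= B.
  have pch : psd (c *: h) by apply: psdZ.
  rewrite -subr_ge0.
  have := addr_ge0 (psd_trM_ge0 (bY k) (pY k)) (psd_trM_ge0 pch (bY k)).
  by rewrite mulmxBl mulmxBr 2!mxtraceB -eB -ea addrC addrA subrK.
have lc k : a k.+1 ^+ 2 <= a k * a k.+2.
  rewrite !ea {1}YS dL -!YS; exact: (mxtrace_CauchySchwarz (pY k) (pY k.+2)).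
(* The traces are nonnegative complex numbers; the growth argument uses the Archimedean property, so
   it is run on their real parts. *)
have rea k : (complex.Re (a k))%:C%C = a k by apply/RRe_real/ger0_real.
have reB : (complex.Re B)%:C%C = B by apply/RRe_real/ger0_real; apply: le_trans (aB 0%N).
rewrite -Y0 -YS -!ea; suff : complex.Re (a 1%N) <= complex.Re (a 0%N) by rewrite -lecR !rea.
apply: (@bounded_log_convex (fun k => complex.Re (a k)) (complex.Re B)) => k.
- by rewrite -lecR rea.
- by rewrite -lecR reB rea.
- by rewrite -lecR rmorphXn rmorphM /= !rea.
Qed.

End Contraction.

(** * Recovery by the Petz map *)

Section Recovery.
Variable R : realType.
Local Notation C := R[i].

Lemma quarter_rootE n (W q qi : 'M[C]_n) : quarter_root W q qi ->
  [/\ q^H = q, qi^H = qi, q *m (q *m qi) = q, q *m qi *m q = q &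
      qi *m (q *m qi) = qi /\ q *m qi *m qi = qi].
Proof.
case=> pq pqi _ cqi [q1 q2]; split; rewrite ?psd_adj //.
  by rewrite cqi mulmxA q1.
by split; [rewrite mulmxA q2 | rewrite cqi q2].
Qed.

Lemma quarter_projE n (W q qi : 'M[C]_n) : quarter_root W q qi ->
  (q *m qi)^H = q *m qi /\ q *m qi *m (q *m qi) = q *m qi.
Proof.
move=> qW; have [hq hqi q1 q2 [q3 q4]] := quarter_rootE qW.
split; last by rewrite mulmxA q2.
by case: qW => _ _ _ cqi _; rewrite adjmxM hq hqi cqi.
Qed.

(** This lets a dominated matrix be divided by the roots of [W] and multiplied back without loss,
    even when [W] is singular. *)
Lemma quarter_dominated n (W q qi A : 'M[C]_n) c : quarter_root W q qi ->
  psd A -> psd (c *: W - A) -> A *m (q *m qi) = A /\ q *m qi *m A = A.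
Proof.
move=> qW pA pcA; have [_ _ q1 _ _] := quarter_rootE qW.
have [hP _] := quarter_projE qW; case: qW => _ _ eW _ _.
have kA : A *m (1%:M - q *m qi) = 0.
  apply: (psd_dominated_ker pA pcA).
  rewrite -eW mulmxBr mulmx1; apply/eqP; rewrite subr_eq0 eq_sym; apply/eqP.
  by rewrite -(mulmxA (q *m q)) -(mulmxA q q (q *m qi)) q1.
have AP : A *m (q *m qi) = A.
  by apply/esym/subr0_eq; rewrite -[X in X - _]mulmx1 -mulmxBr.
by split=> //; rewrite -{1}(psd_adj pA) -hP -adjmxM AP psd_adj.
Qed.

Lemma psd_quarter_proj n (W q qi : 'M[C]_n) : quarter_root W q qi ->
  psd (1%:M - q *m qi).
Proof.
move=> qW; have [hP PP] := quarter_projE qW.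
have -> : 1%:M - q *m qi = (1%:M - q *m qi)^H *m (1%:M - q *m qi).
  by rewrite adjmxB adjmx1 hP mulmxBr mulmx1 mulmxBl mul1mx PP subrr subr0.
exact: psd_gram.
Qed.

Section Normalized.
Variables (n p : nat) (T : 'M[C]_n -> 'M[C]_p) (W q qi : 'M[C]_n) (W' h hi : 'M[C]_p).
Hypotheses (lT : linear T) (tT : trace_preserving T) (pT : positive_map T).
Hypotheses (TW : T W = W') (qW : quarter_root W q qi) (hW' : quarter_root W' h hi).

Definition normalized X := hi *m T (q *m X *m q) *m hi.
Definition normalized_dual Y := q *m trdual T (hi *m Y *m hi) *m q.

Lemma normalized_linear : linear normalized.
Proof.
move=> a X Y; rewrite /normalized mulmxDr mulmxDl -scalemxAr -scalemxAl lT.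
by rewrite mulmxDr mulmxDl -scalemxAr -scalemxAl.
Qed.

Lemma normalized_dual_linear : linear normalized_dual.
Proof.
move=> a X Y; rewrite /normalized_dual mulmxDr mulmxDl -scalemxAr -scalemxAl.
by rewrite trdual_linear mulmxDr mulmxDl -scalemxAr -scalemxAl.
Qed.

Lemma psd_conj_herm m (K A : 'M[C]_m) : K^H = K -> psd A -> psd (K *m A *m K).
Proof. by move=> hK pA; rewrite -{1}hK; apply: psd_conj. Qed.

Lemma normalized_positive : positive_map normalized.
Proof.
have [hq hqi _ _ _] := quarter_rootE qW; have [hh hhi _ _ _] := quarter_rootE hW'.
by move=> X pX; apply: psd_conj_herm => //; apply: pT; apply: psd_conj_herm.
Qed.

Lemma normalized_dual_positive : positive_map normalized_dual.
Proof.
have [hq hqi _ _ _] := quarter_rootE qW; have [hh hhi _ _ _] := quarter_rootE hW'.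
move=> X pX; apply: psd_conj_herm => //; apply: trdual_positive => //.
exact: psd_conj_herm.
Qed.

Lemma normalized_dualE Y X :
  \tr (normalized_dual Y *m X) = \tr (Y *m normalized X).
Proof.
rewrite /normalized_dual -!mulmxA mxtrace_mulC -(mulmxA (trdual _ _)) trdualE //.
by rewrite /normalized [in RHS]mulmxA [RHS]mxtrace_mulC !mulmxA.
Qed.

Let L X := normalized_dual (normalized X).

Lemma normalized_sqrt : normalized (q *m q) = h *m h.
Proof.
have [_ _ h1 h2 [h3 h4]] := quarter_rootE hW'; case: qW => _ _ eW _ _.
case: hW' => _ _ eW' chi _.
have qqW : q *m (q *m q) *m q = W by rewrite -eW !mulmxA.
by rewrite /normalized qqW TW -eW' !mulmxA -chi h2 -!mulmxA h1.
Qed.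

(** Conjugating [h *m h] by [hi] leaves the support projection of [W'], which is at most 1, and
    [trdual T] is positive and unital. Singularity of [W'] is why this is an inequality. *)
Lemma normalized_dual_sqrt : psd (q *m q - normalized_dual (h *m h)).
Proof.
have [hq _ _ _ _] := quarter_rootE qW.
have [_ _ h1 h2 [h3 h4]] := quarter_rootE hW'.
rewrite /normalized_dual.
have -> : hi *m (h *m h) *m hi = h *m hi.
  by case: hW' => _ _ _ chi _; rewrite mulmxA -chi h2.
set P := h *m hi; have -> : q *m q - q *m trdual T P *m q = q *m (1%:M - trdual T P) *m q.
  by rewrite mulmxBr mulmxBl mulmx1.
apply: psd_conj_herm => //; rewrite -(trdual1 lT tT) -(linear_fB (trdual_linear T)).
by apply: trdual_positive => //; apply: psd_quarter_proj hW'.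
Qed.

Lemma normalized_contraction c X : 0 <= c -> psd X -> psd (c *: (q *m q) - X) ->
  \tr (L X *m L X) <= \tr (X *m X).
Proof.
have [hq _ _ _ _] := quarter_rootE qW.
apply: selfdual_contraction.
- by move=> a A B; rewrite /L normalized_linear normalized_dual_linear.
- by move=> A B; rewrite /L normalized_dualE mxtrace_mulC -normalized_dualE mxtrace_mulC.
- by move=> A pA; apply/normalized_dual_positive/normalized_positive.
- by rewrite -{1}hq; apply: psd_gram.
- by rewrite /L normalized_sqrt; apply: normalized_dual_sqrt.
Qed.

(** Duality gives [\tr (F X *m F X) = \tr (L X *m X)] for F = [normalized]; Cauchy-Schwarz and the
    contraction by [L] bound it by [\tr (X *m X)]. *)
Lemma normalized_contractive c X : 0 <= c -> psd X -> psd (c *: (q *m q) - X) ->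
  \tr (normalized X *m normalized X) <= \tr (X *m X).
Proof.
move=> c0 pX pcX; have le1 := normalized_contraction c0 pX pcX.
have pL : psd (L X) by apply/normalized_dual_positive/normalized_positive.
have := mxtrace_CauchySchwarz pL pX.
rewrite {1}/L normalized_dualE.
have t0 := psd_trM_ge0 (normalized_positive pX) (normalized_positive pX).
have t1 := psd_trM_ge0 pX pX.
move=> /le_trans/(_ (ler_wpM2r t1 le1)); rewrite -expr2.
by rewrite ler_pXn2r // nnegrE.
Qed.

End Normalized.

(* Both [T] and [Phi] are contractions for the norms
   [tr (W^(-1/2) X W^(-1/2) X)], so [T] preserves the norm of [rho] when
   [Phi] undoes [T]; the adjoint of [T] for these norms is the Petz map. *)
Lemma petz_recovery n p (T : 'M[C]_n -> 'M[C]_p) (Phi : 'M[C]_p -> 'M[C]_n)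
    (W q qi rho : 'M[C]_n) (h hi : 'M[C]_p) c :
  linear T -> trace_preserving T -> positive_map T ->
  linear Phi -> trace_preserving Phi -> positive_map Phi ->
  quarter_root W q qi -> quarter_root (T W) h hi ->
  Phi (T W) = W -> 0 <= c -> psd rho -> psd (c *: W - rho) -> Phi (T rho) = rho ->
  q *m q *m trdual T (hi *m hi *m T rho *m (hi *m hi)) *m (q *m q) = rho.
Proof.
move=> lT tT pT lP tP pP qW hW PTW c0 prho pcrho PTrho.
have [hq hqi q1 q2 [q3 q4]] := quarter_rootE qW.
have [hh hhi h1 h2 [h3 h4]] := quarter_rootE hW.
have [rP Pr] := quarter_dominated qW prho pcrho.
have pcT : psd (c *: T W - T rho) by rewrite -(linear_fZ lT) -(linear_fB lT); apply: pT.
have [TP PT] := quarter_dominated hW (pT _ prho) pcT.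
have [_ _ eW cq _] := qW; have [_ _ eTW ch _] := hW.
have [X eX] : exists X, X = qi *m rho *m qi by exists (qi *m rho *m qi).
have [Y eY] : exists Y, Y = hi *m T rho *m hi by exists (hi *m T rho *m hi).
have qXq : q *m X *m q = rho by rewrite eX !mulmxA -(mulmxA _ qi q) -cq Pr rP.
have hYh : h *m Y *m h = T rho by rewrite eY !mulmxA -(mulmxA _ hi h) -ch PT TP.
have FX : normalized T q hi X = Y by rewrite /normalized qXq eY.
have FY : normalized Phi h qi Y = X by rewrite /normalized hYh PTrho eX.
have pX : psd X by rewrite eX; apply: (psd_conj_herm hqi prho).
have pY : psd Y by rewrite eY; apply: (psd_conj_herm hhi (pT _ prho)).
(* The bound [rho <= c W], conjugated by [qi], becomes the order bound that the contraction
   requires. *)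
have pcX : psd (c *: (q *m q) - X).
  have -> : c *: (q *m q) - X = qi *m (c *: W - rho) *m qi.
    rewrite mulmx_conj_lincomb eX; have -> // : qi *m W *m qi = q *m q.
    by rewrite -eW !mulmxA -cq q2 -!mulmxA q1.
  exact: (psd_conj_herm hqi pcrho).
have pcY : psd (c *: (h *m h) - Y).
  have -> : c *: (h *m h) - Y = hi *m (c *: T W - T rho) *m hi.
    rewrite mulmx_conj_lincomb eY; have -> // : hi *m T W *m hi = h *m h.
    by rewrite -eTW !mulmxA -ch h2 -!mulmxA h1.
  exact: (psd_conj_herm hhi pcT).
have le1 := normalized_contractive lT tT pT (erefl _) qW hW c0 pX pcX.
have le2 := normalized_contractive lP tP pP PTW hW qW c0 pY pcY.
have le3 := normalized_contraction lT tT pT (erefl _) qW hW c0 pX pcX.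
rewrite FX in le1 le3; rewrite FY in le2.
(* F sends [X] to [Y] and the normalized [Phi] sends [Y] back to [X], so neither can shrink the
   norm. *)
have eXY : \tr (Y *m Y) = \tr (X *m X) by apply/le_anti/andP.
(* The squared distance from [L X] to [X] is the norm of [L X] squared, minus twice that of [Y],
   plus that of [X]; with equal norms for [X] and [Y] it is at most 0. *)
have eLX : normalized_dual T q hi Y = X.
  apply/subr0_eq/mxtrace_gram_le0.
  have pL : psd (normalized_dual T q hi Y) by apply: (normalized_dual_positive lT pT qW hW).
  rewrite adjmxB (psd_adj pL) (psd_adj pX) mxtrace_sqrB (normalized_dualE _ _ lT Y X).
  by rewrite FX eXY mulr2n opprD addrA subrK subr_le0.
by rewrite -{2}qXq -eLX /normalized_dual eY !mulmxA.
Qed.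

End Recovery.

(** * Partial trace and complete positivity *)

Section TensIndex.
Variable K : comPzRingType.

Lemma sum_mxtens m n (F : 'I_(m * n) -> K) :
  \sum_k F k = \sum_i \sum_j F (mxtens_index (i, j)).
Proof.
rewrite pair_big /= (reindex (@mxtens_index m n)) /=.
  by apply: eq_bigr => [[i j]] _.
by exists (@mxtens_unindex m n) => k _; rewrite (mxtens_indexK, mxtens_unindexK).
Qed.

Lemma matrix_tensP m n p q (A B : 'M[K]_(m * n, p * q)) :
  (forall i j k l, A (mxtens_index (i, j)) (mxtens_index (k, l)) =
                   B (mxtens_index (i, j)) (mxtens_index (k, l))) -> A = B.
Proof.
move=> eAB; apply/matrixP=> i j.
by case: (mxtens_indexP i) => ? ?; case: (mxtens_indexP j) => ? ?.
Qed.

Lemma mxtrace_tens m n (A : 'M[K]_m) (B : 'M[K]_n) : \tr (A *t B) = \tr A * \tr B.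
Proof.
rewrite {1}/mxtrace sum_mxtens /mxtrace mulr_suml; apply: eq_bigr => i _.
by rewrite mulr_sumr; apply: eq_bigr => j _; rewrite tensmxE.
Qed.

Lemma tensmx11 m n : (1%:M : 'M[K]_m) *t (1%:M : 'M[K]_n) = 1%:M.
Proof.
apply: matrix_tensP => i j k l; rewrite tensmxE !mxE -natrM mulnb; congr (_%:R).
by rewrite (can_eq (@mxtens_indexK m n)) xpair_eqE.
Qed.

Lemma tensmxDl m n p q (A B : 'M[K]_(m, n)) (X : 'M[K]_(p, q)) :
  (A + B) *t X = A *t X + B *t X.
Proof. by apply/matrixP=> i j; rewrite !mxE mulrDl. Qed.

Lemma tensmxZl m n p q a (A : 'M[K]_(m, n)) (X : 'M[K]_(p, q)) :
  (a *: A) *t X = a *: (A *t X).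
Proof. by apply/matrixP=> i j; rewrite !mxE mulrA. Qed.

Lemma tensmxZr m n p q a (A : 'M[K]_(m, n)) (X : 'M[K]_(p, q)) :
  A *t (a *: X) = a *: (A *t X).
Proof. by apply/matrixP=> i j; rewrite !mxE mulrCA. Qed.

(* [emb e] maps [x] to [x *t e]. *)
Definition emb m n (e : 'I_n) : 'M[K]_(m * n, m) :=
  \matrix_(k, j) ((mxtens_unindex k == (j, e))%:R).

Lemma emb_conjE m n (e e' : 'I_n) (X : 'M[K]_(m * n)) i j :
  ((emb m e)^T *m X *m emb m e') i j = X (mxtens_index (i, e)) (mxtens_index (j, e')).
Proof.
rewrite mxE (bigD1 (mxtens_index (j, e'))) //= big1 ?addr0 => [|k nk].
  rewrite [X in _ * X]mxE mxtens_indexK eqxx mulr1 mxE (bigD1 (mxtens_index (i, e))) //=.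
  rewrite big1 ?addr0 => [|k nk]; first by rewrite !mxE mxtens_indexK eqxx mul1r.
  rewrite !mxE; case: eqP => [ek|]; last by rewrite mul0r.
  by rewrite -ek mxtens_unindexK eqxx in nk.
rewrite [X in _ * X]mxE; case: eqP => [ek|]; last by rewrite mulr0.
by rewrite -ek mxtens_unindexK eqxx in nk.
Qed.

End TensIndex.

Section PartialTrace.
Variable R : realType.
Local Notation C := R[i].

Lemma emb_adj m n (e : 'I_n) : (emb C m e)^H = (emb C m e)^T.
Proof. by apply/matrixP=> i j; rewrite !mxE rmorph_nat. Qed.

Variables dS dE : nat.
Implicit Types X : 'M[C]_(dS * dE).

Lemma ptrE_kraus X : ptrE X = \sum_e (emb C dS e)^H *m X *m emb C dS e.
Proof.
apply/matrixP=> i j; rewrite mxE summxE; apply: eq_bigr => e _.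
by rewrite emb_adj emb_conjE.
Qed.

Lemma ptrE_linear : linear (@ptrE R dS dE).
Proof.
move=> a X Y; apply/matrixP=> i j; rewrite !mxE mulr_sumr -big_split /=.
by apply: eq_bigr => e _; rewrite !mxE.
Qed.

Lemma ptrE_positive : positive_map (@ptrE R dS dE).
Proof. by move=> X pX; rewrite ptrE_kraus; apply: psd_sum => e _; apply: psd_conj. Qed.

Lemma ptrE_tr : trace_preserving (@ptrE R dS dE).
Proof. by move=> X; rewrite [RHS]sum_mxtens; apply: eq_bigr => i _; rewrite mxE. Qed.

Lemma ptrE_adj X : ptrE X^H = (ptrE X)^H.
Proof.
by apply/matrixP=> i j; rewrite !mxE rmorph_sum; apply: eq_bigr => e _; rewrite !mxE.
Qed.

Lemma ptrE_mulr X (D : 'M[C]_dS) : ptrE (X *m (D *t 1%:M)) = ptrE X *m D.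
Proof.
apply/matrixP=> i j; rewrite !mxE.
under [RHS]eq_bigr do rewrite mxE mulr_suml.
rewrite exchange_big /=; apply: eq_bigr => e _.
rewrite mxE sum_mxtens; apply: eq_bigr => k _.
rewrite (bigD1 e) //= big1 ?addr0 => [|e' /negPf ne].
  by rewrite tensmxE !mxE eqxx mulr1.
by rewrite tensmxE !mxE ne !mulr0.
Qed.

Lemma ptrE_mull X (D : 'M[C]_dS) : ptrE ((D *t 1%:M) *m X) = D *m ptrE X.
Proof.
rewrite -[_ *m X]adjmxK ptrE_adj adjmxM adjmx_tens adjmx1 ptrE_mulr.
by rewrite adjmxM ptrE_adj !adjmxK.
Qed.

Lemma mxtrace_ptrE_mul X (D : 'M[C]_dS) :
  \tr (ptrE X *m D) = \tr (X *m (D *t 1%:M)).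
Proof. by rewrite -ptrE_mulr ptrE_tr. Qed.

Lemma trdual_ptrE (D : 'M[C]_dS) : trdual (@ptrE R dS dE) D = D *t 1%:M.
Proof.
apply: mxtrace_mul_inj => X; rewrite (trdualE _ _ ptrE_linear).
by rewrite mxtrace_mulC mxtrace_ptrE_mul mxtrace_mulC.
Qed.

Lemma ptrE_tens (A : 'M[C]_dS) (B : 'M[C]_dE) : ptrE (A *t B) = \tr B *: A.
Proof.
apply/matrixP=> i j; rewrite !mxE mulr_suml; apply: eq_bigr => e _.
by rewrite tensmxE mulrC.
Qed.

End PartialTrace.

Section CompletePositivity.
Variable R : realType.
Local Notation C := R[i].

Definition block k n (X : 'M[C]_(k * n)) (a b : 'I_k) : 'M[C]_n :=
  \matrix_(i, j) X (mxtens_index (a, i)) (mxtens_index (b, j)).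

(** On blocks the amplification acts entrywise, so identities between amplifications reduce to
    identities between the maps themselves. *)
Lemma amplE k n p (f : 'M[C]_n -> 'M[C]_p) (X : 'M[C]_(k * n)) a b :
  block (ampl f X) a b = f (block X a b).
Proof.
apply/matrixP=> i j; rewrite mxE /ampl summxE (bigD1 a) //= [X in _ + X]big1 => [|a' na].
  rewrite addr0 summxE (bigD1 b) //= [X in _ + X]big1 => [|b' nb].
    by rewrite addr0 tensmxE mxE !eqxx mul1r.
  by rewrite tensmxE mxE (eq_sym b) (negPf nb) andbF mul0r.
by rewrite summxE big1 // => b' _; rewrite tensmxE mxE (eq_sym a) (negPf na) mul0r.
Qed.

Lemma blockP k n (X Y : 'M[C]_(k * n)) : (forall a b, block X a b = block Y a b) -> X = Y.
Proof.
move=> eXY; apply: matrix_tensP => a i b j.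
by have /matrixP/(_ i j) := eXY a b; rewrite !mxE.
Qed.

Lemma block_conj k n p (K : 'M[C]_(p, n)) (X : 'M[C]_(k * n)) a b :
  block ((1%:M *t K) *m X *m (1%:M *t K)^H) a b = K *m block X a b *m K^H.
Proof.
have e1 (A : 'M[C]_(k * n, k * p)) i j :
    ((1%:M *t K) *m A) (mxtens_index (a, i)) j = \sum_x K i x * A (mxtens_index (a, x)) j.
  rewrite mxE sum_mxtens (bigD1 a) //= [X in _ + X]big1 ?addr0 => [|a' /negPf na].
    by apply: eq_bigr => x _; rewrite tensmxE mxE eqxx mul1r.
  by rewrite big1 // => x _; rewrite tensmxE mxE eq_sym na !mul0r.
apply/matrixP=> i j; rewrite mxE -mulmxA e1 -mulmxA mxE; apply: eq_bigr => x _.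
congr (_ * _); rewrite mxE sum_mxtens (bigD1 b) //= [X in _ + X]big1 ?addr0 => [|b' /negPf nb].
  rewrite mxE; apply: eq_bigr => y _.
  by rewrite adjmx_tens adjmx1 tensmxE !mxE eqxx mul1r.
by rewrite big1 // => y _; rewrite adjmx_tens adjmx1 tensmxE mxE nb mul0r mulr0.
Qed.

Lemma block_sum k n (I : finType) (F : I -> 'M[C]_(k * n)) a b :
  block (\sum_i F i) a b = \sum_i block (F i) a b.
Proof.
by apply/matrixP=> i j; rewrite mxE !summxE; apply: eq_bigr => x _; rewrite mxE.
Qed.

Lemma kraus_completely_positive n p (I : finType) (K : I -> 'M[C]_(p, n))
    (f : 'M[C]_n -> 'M[C]_p) :
  (forall X, f X = \sum_i K i *m X *m (K i)^H) -> completely_positive f.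
Proof.
move=> ef k X pX.
have -> : ampl f X = \sum_i (1%:M *t K i) *m X *m (1%:M *t K i)^H.
  apply: blockP => a b; rewrite amplE ef block_sum.
  by apply: eq_bigr => i _; rewrite block_conj.
by apply: psd_sum => i _; apply: psd_conjr.
Qed.

Lemma completely_positive_comp n p r (f : 'M[C]_n -> 'M[C]_p) (g : 'M[C]_p -> 'M[C]_r) :
  completely_positive f -> completely_positive g -> completely_positive (g \o f).
Proof.
move=> cf cg k X pX; have -> : ampl (g \o f) X = ampl g (ampl f X).
  by apply: blockP => a b; rewrite !amplE.
exact/cg/cf.
Qed.

Lemma completely_positiveD n p (f g : 'M[C]_n -> 'M[C]_p) :
  completely_positive f -> completely_positive g ->
  completely_positive (fun X => f X + g X).
Proof.
move=> cf cg k X pX.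
have -> : ampl (fun X => f X + g X) X = ampl f X + ampl g X.
  apply: blockP => a b; rewrite amplE -(amplE f) -(amplE g).
  by apply/matrixP=> i j; rewrite !mxE.
by apply: psdD; [apply: cf | apply: cg].
Qed.

Lemma conj_completely_positive n p (K : 'M[C]_(p, n)) :
  completely_positive (fun X => K *m X *m K^H).
Proof.
by apply: (@kraus_completely_positive _ _ 'I_1 (fun=> K)) => X; rewrite big_ord1.
Qed.

Lemma ptrE_completely_positive dS dE : completely_positive (@ptrE R dS dE).
Proof.
apply: (@kraus_completely_positive _ _ 'I_dE (fun e => (emb C dS e)^H)) => X.
by rewrite ptrE_kraus; apply: eq_bigr => e _; rewrite adjmxK.
Qed.

Lemma tens1_completely_positive dS dE :
  completely_positive (fun X : 'M[C]_dS => X *t (1%:M : 'M[C]_dE)).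
Proof.
apply: (@kraus_completely_positive _ _ 'I_dE (fun e => emb C dS e)) => X.
apply: matrix_tensP => i x j y; rewrite tensmxE summxE.
have e1 e : (emb C dS e *m X *m (emb C dS e)^H) (mxtens_index (i, x)) (mxtens_index (j, y)) =
    X i j * (x == e)%:R * (y == e)%:R.
  rewrite mxE (bigD1 j) //= big1 ?addr0 => [|k /negPf nk].
    rewrite mxE (bigD1 i) //= big1 ?addr0 => [|k /negPf nk].
      rewrite emb_adj !mxE !mxtens_indexK !xpair_eqE !eqxx /=.
      by congr (_ * _); rewrite mulrC.
    by rewrite !mxE !mxtens_indexK !xpair_eqE (eq_sym i) nk mul0r.
  by rewrite emb_adj !mxE !mxtens_indexK !xpair_eqE (eq_sym j) nk mulr0.
rewrite (eq_bigr _ (fun e _ => e1 e)) (bigD1 x) //= big1 => [|e /negPf ne].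
  by rewrite addr0 mxE eqxx mulr1 eq_sym.
by rewrite (eq_sym x) ne mulr0 mul0r.
Qed.

(** Measure [Q], then prepare [G *m G]. Writing the prepared state as a square exhibits the Kraus
    operators [G *m delta_mx s t *m Q]. *)
Lemma prepare_completely_positive n p (Q : 'M[C]_n) (G : 'M[C]_p) :
  Q^H = Q -> Q *m Q = Q -> G^H = G ->
  completely_positive (fun X => \tr (Q *m X) *: (G *m G)).
Proof.
move=> hQ QQ hG.
apply: (@kraus_completely_positive _ _ ('I_p * 'I_n)%type
         (fun st => G *m delta_mx st.1 st.2 *m Q)) => X.
rewrite -(pair_bigA _ (fun s t => G *m delta_mx s t *m Q *m X *m (G *m delta_mx s t *m Q)^H)) /=.
have e1 s t : G *m delta_mx s t *m Q *m X *m (G *m delta_mx s t *m Q)^H =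
    (Q *m X *m Q) t t *: (G *m delta_mx s s *m G).
  rewrite !adjmxM adjmx_delta hQ hG !mulmxA.
  have -> : G *m delta_mx s t *m Q *m X *m Q *m delta_mx t s *m G =
      G *m (delta_mx s t *m (Q *m X *m Q) *m delta_mx t s) *m G by rewrite !mulmxA.
  have -> : delta_mx s t *m (Q *m X *m Q) *m delta_mx t s = (Q *m X *m Q) t t *: delta_mx s s.
    move: (Q *m X *m Q) => Z; apply/matrixP=> i j.
    rewrite !mxE (bigD1 t) //= big1 ?addr0 => [|k /negPf nk]; last first.
      by rewrite [X in _ * X]mxE nk mulr0.
    rewrite mxE (bigD1 t) //= big1 ?addr0 => [|k /negPf nk]; last first.
      by rewrite mxE nk andbF mul0r.
    rewrite !mxE !eqxx andbT /=; case: (i == s); case: (j == s) => /=;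
    by rewrite ?(mulr0, mul0r, mulr1, mul1r).
  by rewrite -scalemxAr -scalemxAl.
under eq_bigr => s _ do under eq_bigr => t _ do rewrite e1.
under eq_bigr => s _ do rewrite -scaler_suml.
rewrite -scaler_sumr -mulmx_suml -mulmx_sumr.
have -> : \tr (Q *m X) = \sum_t (Q *m X *m Q) t t.
  suff <- : \tr (Q *m X *m Q) = \tr (Q *m X) by [].
  by rewrite mxtrace_mulC mulmxA QQ.
have -> : \sum_s delta_mx s s = 1%:M :> 'M[C]_p.
  apply/matrixP=> i j; rewrite summxE mxE (bigD1 i) //= big1 => [|k /negPf nk].
    by rewrite mxE eqxx addr0 eq_sym.
  by rewrite mxE eq_sym nk.
by rewrite mulmx1.
Qed.

End CompletePositivity.

(** * Minimal projections of a matrix *-algebra *)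

Section StarAlgebra.
Variable R : realType.
Local Notation C := R[i].
Variables (n : nat) (A : 'M[C]_n -> Prop).

Definition projection (p : 'M[C]_n) := p^H = p /\ p *m p = p.

(** Minimality is recorded as a scalar corner, the form in which it is always applied;
    [scalar_corner] derives it from the absence of proper subprojections. *)
Definition minimal_projection p :=
  [/\ A p, projection p, p <> 0 & forall x, A x -> exists c, p *m x *m p = c *: p].

Hypotheses (A1 : A 1%:M) (AM : forall x y, A x -> A y -> A (x *m y)).
Hypotheses (AL : forall c x y, A x -> A y -> A (c *: x + y)).
Hypothesis AH : forall x, A x -> A x^H.

Lemma star_algebra0 : A 0.
Proof. by have := AL (-1) A1 A1; rewrite scaleN1r addNr. Qed.

Lemma star_algebraZ c x : A x -> A (c *: x).
Proof. by move=> Ax; have := AL c Ax star_algebra0; rewrite addr0. Qed.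

Lemma star_algebraB x y : A x -> A y -> A (x - y).
Proof. by move=> Ax Ay; have := AL (-1) Ay Ax; rewrite scaleN1r addrC. Qed.

Lemma star_algebraD x y : A x -> A y -> A (x + y).
Proof. by move=> Ax Ay; have := AL 1 Ax Ay; rewrite scale1r. Qed.

(** A spectral projection of [y] is a polynomial in [y] by Lagrange interpolation, so it stays in
    the algebra. *)
Lemma hermitian_eigenprojection y : A y -> y^H = y -> y <> 0 ->
  exists a e, [/\ A e, projection e, e <> 0, a != 0 & y *m e = a *: e /\ e *m y = a *: e].
Proof.
move=> Ay hy ny; have [U [d [UU UU' ey]]] := hermitian_spectral hy.
have [fc efc] : exists fc : 'rV[C]_n -> 'M[C]_n,
    forall v, fc v = U^H *m diag_mx v *m U by exists (fun v => U^H *m diag_mx v *m U).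
have fcM u v : fc u *m fc v = fc (\row_i (u 0 i * v 0 i)).
  by rewrite !efc conj_diag_mul.
have fcZ c u : c *: fc u = fc (\row_i (c * u 0 i)).
  have -> : \row_i (c * u 0 i) = c *: u by apply/rowP=> i; rewrite !mxE.
  by rewrite !efc linearZ /= -scalemxAr -scalemxAl.
rewrite -efc in ey.
have [i0 di0] : exists i, d 0 i != 0.
  apply: contrapT => nd; apply: ny; rewrite ey.
  have -> : d = 0.
    by apply/rowP=> i; rewrite mxE; apply: contrapT => /eqP ?; apply: nd; exists i.
  by rewrite efc linear0 mulmx0 mul0mx.
have poly s : A (fc (\row_i \prod_(b <- s) (d 0 i - b))).
  elim: s => [|b s IH].
    suff -> : fc (\row_i \prod_(b <- [::]) (d 0 i - b)) = 1%:M by [].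
    rewrite efc -UU'; congr (_ *m _); rewrite -[RHS]mulmx1; congr (_ *m _).
    by apply/matrixP=> i j; rewrite !mxE big_nil.
  have -> : fc (\row_i \prod_(b0 <- b :: s) (d 0 i - b0)) =
      (y - b *: 1%:M) *m fc (\row_i \prod_(b <- s) (d 0 i - b)).
    rewrite mulmxBl -scalemxAl mul1mx ey fcM fcZ.
    have fcB u v : fc u - fc v = fc (u - v).
      by rewrite !efc linearB /= mulmxBr mulmxBl.
    rewrite fcB; congr fc; apply/rowP=> i.
    by rewrite !mxE big_cons mulrBl.
  by apply: AM => //; apply: star_algebraB => //; apply: star_algebraZ.
(* [s] lists the eigenvalues other than the chosen one: the product over [s] vanishes at each of
   them, and [c] is its value at the chosen one. Repetitions in [s] are harmless. *)
pose s := [seq b <- [seq d 0 i | i <- enum 'I_n] | b != d 0 i0].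
pose c := \prod_(b <- s) (d 0 i0 - b).
have nc : c != 0.
  rewrite prodf_seq_neq0; apply/allP=> b; rewrite mem_filter => /andP[nb _].
  by rewrite subr_eq0 eq_sym.
have ee : c^-1 *: fc (\row_i \prod_(b <- s) (d 0 i - b)) =
    fc (\row_i (d 0 i == d 0 i0)%:R).
  rewrite fcZ; congr fc; apply/rowP=> i; rewrite !mxE.
  have [->|ni] := eqVneq (d 0 i) (d 0 i0); first by rewrite mulVf.
  suff -> : \prod_(b <- s) (d 0 i - b) = 0 by rewrite mulr0.
  apply/eqP; rewrite prodf_seq_eq0; apply/hasP; exists (d 0 i); last by rewrite subrr eqxx.
  by rewrite mem_filter ni; apply: map_f; rewrite mem_enum.
exists (d 0 i0), (fc (\row_i (d 0 i == d 0 i0)%:R)); split => //.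
- by rewrite -ee; apply: star_algebraZ.
- split; last first.
    rewrite fcM; congr fc; apply/rowP=> i; rewrite !mxE -natrM.
    by case: eqP.
  rewrite efc !adjmxM adjmxK mulmxA; congr (_ *m _ *m _).
  apply/matrixP=> i j; rewrite !mxE rmorphMn rmorph_nat.
  by have [->|_] := eqVneq j i.
- rewrite efc => /(congr1 (fun x => U *m x *m U^H)).
  rewrite !mulmxA UU mul1mx -mulmxA UU mulmx1 mulmx0 mul0mx => /matrixP/(_ i0 i0).
  by rewrite !mxE !eqxx /= => /eqP; rewrite oner_eq0.
- split; rewrite ey fcM fcZ; congr fc; apply/rowP=> i; rewrite !mxE.
    by case: eqP => [->//|_]; rewrite !mulr0.
  by case: eqP => [->|_]; rewrite ?mulr0 ?mul0r // mulrC.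
Qed.

Lemma projection_sub p q : projection p -> projection q -> q *m p = p ->
  projection (q - p).
Proof.
move=> [hp pp] [hq qq] qp; have pq : p *m q = p by rewrite -{1}hp -hq -adjmxM qp hp.
by split; rewrite ?adjmxB ?hp ?hq // mulmxBr !mulmxBl qq pq qp pp subrr subr0.
Qed.

Lemma mxrank_projection_lt (e q : 'M[C]_n) : e *m e = e -> q *m e = e -> e *m q = e -> e <> q ->
  (\rank e < \rank q)%N.
Proof.
move=> ee qe eq_ ne; have le_eq : (e <= q)%MS by rewrite -eq_ submxMl.
rewrite (ltn_leqif (mxrank_leqif_sup le_eq)); apply/negP=> /submxP[X eX].
by apply: ne; rewrite -qe {1}eX -mulmxA ee -eX.
Qed.

Lemma projection_mulC p q : projection p -> projection q -> q *m p = p -> p *m q = p.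
Proof. by move=> [hp _] [hq _] qp; rewrite -{1}hp -hq -adjmxM qp hp. Qed.

(** The eigenprojection of a nonzero hermitian element of the corner lies under [q], hence is [q],
    so that element is scalar. A general element is split into its hermitian and skew parts. *)
Lemma scalar_corner q : A q -> projection q -> q <> 0 ->
  (forall e, A e -> projection e -> e <> 0 -> q *m e = e -> e = q) ->
  minimal_projection q.
Proof.
move=> Aq pq nq minq; split=> //.
have [hq qq] := pq.
have herm z : A z -> z^H = z -> q *m z = z -> z *m q = z -> exists c, z = c *: q.
  move=> Az hz qz zq; have [->|nz] := pselect (z = 0); first by exists 0; rewrite scale0r.
  have [a [e [Ae pe ne na [ze ez]]]] := hermitian_eigenprojection Az hz nz.
  exists a; rewrite -(minq e) // ?ze //.
    rewrite -ze; suff -> : e = q by rewrite zq.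
    apply: minq => //.
    by apply: (scalerI na); rewrite scalemxAr -ze mulmxA qz.
  by apply: (scalerI na); rewrite scalemxAr -ze mulmxA qz.
move=> x Ax; set y := q *m x *m q.
have Ay : A y by apply: (AM (AM Aq Ax) Aq).
have qy : q *m y = y by rewrite /y !mulmxA qq.
have yq : y *m q = y by rewrite /y -!mulmxA qq.
have qyH : q *m y^H = y^H by rewrite -{1}hq -adjmxM yq.
have yHq : y^H *m q = y^H by rewrite -{1}hq -adjmxM qy.
clearbody y; have AyH := AH Ay.
have [c1 e1] : exists c, y + y^H = c *: q.
  apply: herm; first exact: star_algebraD.
  - by rewrite adjmxD adjmxK addrC.
  - by rewrite mulmxDr qy qyH.
  - by rewrite mulmxDl yq yHq.
have [c2 e2] : exists c, 'i *: (y - y^H) = c *: q.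
  apply: herm; first by apply/star_algebraZ/star_algebraB.
  - by rewrite adjmxZ adjmxB adjmxK conjCi scaleNr -scalerN opprB.
  - by rewrite -scalemxAr mulmxBr qy qyH.
  - by rewrite -scalemxAl mulmxBl yq yHq.
exists (2^-1 * (c1 - 'i * c2)).
have e3 : y - y^H = - (('i * c2) *: q).
  by rewrite -scalerA -e2 scalerA -expr2 sqrCi scaleN1r opprK.
rewrite -scalerA scalerBl -e1 -e3.
have -> : y + y^H + (y - y^H) = (2 : C) *: y.
  by rewrite addrC -addrA (addrCA (- _)) (addrC (- _)) subrr addr0 scaler_nat mulr2n.
by rewrite scalerA mulVf ?pnatr_eq0 // scale1r.
Qed.

Lemma minimal_projection_exists q : A q -> projection q -> q <> 0 ->
  exists p, minimal_projection p /\ q *m p = p.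
Proof.
move: {2}(\rank q) (leqnn (\rank q)) => r; elim: r q => [|r IH] q rq Aq pq nq.
  by case: nq; apply/eqP; rewrite -mxrank_eq0 -leqn0.
have [minq|] := pselect (forall e, A e -> projection e -> e <> 0 -> q *m e = e -> e = q).
  by exists q; split; [apply: scalar_corner | case: pq].
move=> /existsNP[e /not_implyP[Ae /not_implyP[pe /not_implyP[ne /not_implyP[qe neq]]]]].
have [_ ee] := pe; have eq_ := projection_mulC pe pq qe.
have := mxrank_projection_lt ee qe eq_ neq => lt.
have [p [mp ep]] := IH e (leq_trans lt rq) Ae pe ne.
by exists p; split => //; rewrite -ep mulmxA qe.
Qed.

(** Induction on the rank: removing a minimal projection from [q] leaves a projection of the algebra
    of smaller rank. *)
Lemma minimal_projection_decomposition q : A q -> projection q ->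
  exists s : seq 'M[C]_n, [/\ uniq s, forall p, p \in s -> minimal_projection p /\ q *m p = p,
    {in s &, forall p p', p != p' -> p *m p' = 0} & \sum_(p <- s) p = q].
Proof.
move: {2}(\rank q) (leqnn (\rank q)) => r; elim: r q => [|r IH] q rq Aq pq.
  have -> : q = 0 by apply/eqP; rewrite -mxrank_eq0 -leqn0.
  by exists [::]; split; rewrite ?big_nil.
have [->|nq] := pselect (q = 0); first by exists [::]; split; rewrite ?big_nil.
have [p [mp qp]] := minimal_projection_exists Aq pq nq.
have [Ap pp np _] := mp; have [hp p2] := pp; have [hq q2] := pq.
have pq_ := projection_mulC pp pq qp.
have pqp := projection_sub pp pq qp; set q' := q - p in pqp.
have q'p : q' *m p = 0 by rewrite /q' mulmxBl qp p2 subrr.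
have pq' : p *m q' = 0 by rewrite /q' mulmxBr pq_ p2 subrr.
have qq' : q *m q' = q' by rewrite /q' mulmxBr q2 qp.
have lt : (\rank q' < \rank q)%N.
  apply: mxrank_projection_lt => //; first by case: pqp.
    exact: projection_mulC.
  by move=> e; apply: np; rewrite -qp -e.
have [||s [us ms os ss]] := IH q' (leq_trans lt rq); [exact: star_algebraB | by []|].
have ps x : x \in s -> p *m x = 0.
  by move=> /ms[_ <-]; rewrite mulmxA pq' mul0mx.
have sp x : x \in s -> x *m p = 0.
  move=> xs; have [[_ [hx _] _ _] _] := ms _ xs.
  by rewrite -hp -{1}hx -adjmxM ps // adjmx0.
exists (p :: s); split.
- by rewrite /= us andbT; apply/negP=> /ps pp0; apply: np; rewrite -p2.
- move=> x; rewrite inE => /orP[/eqP-> //|xs].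
  by have [mx q'x] := ms x xs; split => //; rewrite -q'x mulmxA qq'.
- move=> x y; rewrite !inE => /orP[/eqP->|xs] /orP[/eqP->|ys] //.
  + by rewrite eqxx.
  + by move=> _; apply: ps.
  + by move=> _; apply: sp.
  + exact: os.
- by rewrite big_cons ss addrC subrK.
Qed.

Lemma minimal_projections_resolution : exists (N : nat) (p : 'I_N -> 'M[C]_n),
  [/\ forall i, minimal_projection (p i), forall i j, i != j -> p i *m p j = 0 &
      \sum_i p i = 1%:M].
Proof.
have p1 : projection (1%:M : 'M[C]_n) by split; rewrite ?adjmx1 ?mulmx1.
have [s [us ms os ss]] := minimal_projection_decomposition A1 p1.
exists (size s), (fun i => s`_i); split=> [i|i j nij|].
- by have [] := ms _ (mem_nth 0 (ltn_ord i)).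
- by apply: os; rewrite ?mem_nth // nth_uniq.
- by rewrite -ss [RHS](big_nth 0) big_mkord.
Qed.

(** For [z = p *m x *m q], minimality makes [z^H *m z] and [z *m z^H] multiples of [q] and [p];
    rescaling [z] makes the first multiple 1. *)
Lemma minimal_projection_partial_isometry p q x : minimal_projection p ->
  minimal_projection q -> A x -> p *m x *m q <> 0 ->
  exists v, [/\ A v, v *m v^H = p & v^H *m v = q].
Proof.
move=> [Ap [hp pp] np sp] [Aq [hq qq] nq sq] Ax nz.
have [z ez] : exists z, z = p *m x *m q by exists (p *m x *m q).
have Az : A z by rewrite ez; apply: AM => //; apply: AM.
have ezH : z^H = q *m x^H *m p by rewrite ez !adjmxM hp hq mulmxA.
have [c ec] : exists c, z^H *m z = c *: q.
  have [c e1] := sq (x^H *m p *m x) (AM (AM (AH Ax) Ap) Ax).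
  by exists c; rewrite -e1 ezH ez !mulmxA -(mulmxA _ p p) pp.
have [c' ec'] : exists c, z *m z^H = c *: p.
  have [c' e1] := sp (x *m q *m x^H) (AM (AM Ax Aq) (AH Ax)).
  by exists c'; rewrite -e1 ezH ez !mulmxA -(mulmxA _ q q) qq.
have tq : 0 < \tr q.
  have e : \tr (q^H *m q) = \tr q by rewrite hq qq.
  rewrite lt_neqAle eq_sym -e mxtrace_gram_ge0 andbT; apply/eqP=> t0.
  by apply: nq; apply: mxtrace_gram_le0; rewrite t0.
have nz' : z <> 0 by rewrite ez.
have c0 : 0 < c.
  have : 0 < \tr (z^H *m z).
    rewrite lt_neqAle eq_sym mxtrace_gram_ge0 andbT; apply/eqP=> t0.
    by apply/nz'/mxtrace_gram_le0; rewrite t0.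
  by rewrite ec mxtraceZ pmulr_lgt0.
have [v ev] : exists v, v = (sqrtC c)^-1 *: z by exists ((sqrtC c)^-1 *: z).
have rs : ((sqrtC c)^-1)^* = (sqrtC c)^-1.
  by apply: conj_Creal; rewrite realV ger0_real // sqrtC_ge0 ltW.
have ss : (sqrtC c)^-1 * (sqrtC c)^-1 = c^-1 by rewrite -invfM -expr2 sqrtCK.
have vHv : v^H *m v = q.
  by rewrite ev adjmxZ rs -scalemxAl -scalemxAr scalerA ss ec scalerA mulVf ?scale1r ?gt_eqF.
have vq : v *m q = v by rewrite ev ez -scalemxAl -!mulmxA qq.
have [t et] : exists t, v *m v^H = t *: p.
  exists (c^-1 * c').
  by rewrite ev adjmxZ rs -scalemxAl -scalemxAr scalerA ss ec' scalerA.
exists v; split => //; first by rewrite ev; apply: star_algebraZ.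
(* Since [v^H *m v = q], the product [v *m v^H = t *: p] is idempotent, so [t] is 0 or 1; 0 would
   give [v = 0] and thus [q = 0]. *)
have : (v *m v^H) *m (v *m v^H) = v *m v^H.
  by rewrite !mulmxA -(mulmxA v) vHv vq.
rewrite et -scalemxAl -scalemxAr scalerA pp => /eqP.
rewrite -subr_eq0 -scalerBl scaler_eq0 => /orP[|/eqP //].
rewrite -{3}[t]mulr1 -mulrBr mulf_eq0 subr_eq0 => /orP[/eqP t0|/eqP->]; last by rewrite scale1r.
case: nq; rewrite -vHv; suff -> : v = 0 by rewrite mulmx0.
by rewrite -[v]adjmxK (@mxtrace_gram_le0 _ _ _ v^H) ?adjmx0 // adjmxK et t0 scale0r mxtrace0.
Qed.

(* The minimal projections are grouped by Murray-von Neumann equivalence;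
   [V k] lists partial isometries from a representative [p k] onto the members of
   the class [k]. *)
Lemma matrix_units : exists (K : nat) (d : 'I_K -> nat)
    (V : forall k, 'I_(d k) -> 'M[C]_n) (p : 'I_K -> 'M[C]_n),
  [/\ forall k, (0 < d k)%N /\ minimal_projection (p k),
      forall k l, A (V k l) /\ V k l *m p k = V k l,
      (forall k l, (V k l)^H *m V k l = p k) /\
      (forall k l l', l != l' -> (V k l)^H *m V k l' = 0) /\
      (forall k k' l l', k != k' -> (V k l)^H *m V k' l' = 0),
      forall k k' x, k != k' -> A x -> p k *m x *m p k' = 0 &
      \sum_k \sum_l V k l *m (V k l)^H = 1%:M].
Proof.
have [N [p [mp op sp]]] := minimal_projections_resolution.
pose E i j := exists v, [/\ A v, v *m v^H = p i & v^H *m v = p j].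
have pE i : projection (p i) by case: (mp i).
have vp v i : v^H *m v = p i -> v *m p i = v.
  move=> vv; have [hp pp] := pE i; apply/esym/subr0_eq; rewrite -[X in X - _]mulmx1 -mulmxBr.
  apply: mxtrace_gram_le0; rewrite adjmxM -mulmxA (mulmxA v^H) vv mulmxBr mulmx1 pp subrr.
  by rewrite mulmx0 mxtrace0.
have Erefl i : E i i.
  by have [hp pp] := pE i; exists (p i); rewrite hp; split=> //; case: (mp i).
have Esym i j : E i j -> E j i.
  by move=> [v [Av v1 v2]]; exists v^H; rewrite adjmxK; split=> //; apply: AH.
have Etrans j i k : E i j -> E j k -> E i k.
  move=> [v [Av v1 v2]] [w [Aw w1 w2]]; exists (v *m w); split; first exact: AM.
    by rewrite adjmxM !mulmxA -(mulmxA v) w1 vp.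
  by rewrite adjmxM -!mulmxA (mulmxA v^H) v2 -w1 -!mulmxA w2 vp // w2.
(* [pick] depends only on the predicate, so equivalent indices get the same representative. By
   reflexivity the default [i] also lies in the class. *)
pose rep i := odflt i [pick j | `[< E j i >]].
have repE i : E (rep i) i.
  by rewrite /rep; case: pickP => [j /asboolP //|_] /=.
have rep_eq i j : E i j -> rep i = rep j.
  move=> Eij; rewrite /rep.
  have eP : (fun k => `[< E k i >]) =1 (fun k => `[< E k j >]).
    move=> k; apply/asboolP/asboolP => Ek; first exact: Etrans Ek Eij.
    exact: Etrans Ek (Esym _ _ Eij).
  rewrite (eq_pick eP); case: pickP => [//|/(_ j)].
  by move/asboolP; case.
have ex i : exists v, [/\ A v, v *m v^H = p i & v^H *m v = p (rep i)].
  exact/Esym/repE.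
have [W HW] := boolp.choice ex.
have WH i j : i != j -> (W i)^H *m W j = 0.
  move=> nij; have [_ _ Wi] := HW i; have [_ Wi' _] := HW i; have [_ Wj' _] := HW j.
  have e1 : p i *m W i = W i.
    have [hp _] := pE i; rewrite -[W i]adjmxK -{1}hp -adjmxM; congr (_^H).
    by apply: vp; rewrite adjmxK.
  have e2 : p j *m W j = W j.
    have [hp _] := pE j; rewrite -[W j]adjmxK -{1}hp -adjmxM; congr (_^H).
    by apply: vp; rewrite adjmxK.
  have [hp _] := pE i.
  by rewrite -e1 -e2 adjmxM hp -!mulmxA (mulmxA (p i)) op // mul0mx mulmx0.
pose reps := [set i | rep i == i].
have rep_rep i : rep (rep i) = rep i by apply: rep_eq.
pose r (k : 'I_#|reps|) : 'I_N := enum_val k.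
have rr k : rep (r k) = r k.
  by have := enum_valP k; rewrite inE => /eqP.
pose cl k := [set j | rep j == r k].
have cle k (l : 'I_#|cl k|) : rep (enum_val l) = r k.
  by have := enum_valP l; rewrite inE => /eqP.
exists #|reps|, (fun k => #|cl k|), (fun k l => W (enum_val l)), (fun k => p (r k)).
split.
- move=> k; split; last exact: mp.
  by apply/card_gt0P; exists (r k); rewrite inE rr.
- move=> k l; have [AW _ WW] := HW (enum_val l); split => //.
  by apply: vp; rewrite WW cle.
- split; first by move=> k l; have [_ _ ->] := HW (enum_val l); rewrite cle.
  split=> [k l l' nl|k k' l l' nk]; apply: WH; first by rewrite (inj_eq enum_val_inj).
  by apply: contra_neq nk => e; apply: enum_val_inj; rewrite -/(r k) -/(r k') -(cle k l) e cle.
- move=> k k' x nk Ax; apply: contrapT => nz; move/eqP: nk; apply.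
  have Ekk : E (r k) (r k') := minimal_projection_partial_isometry (mp _) (mp _) Ax nz.
  by apply: enum_val_inj; have := rep_eq _ _ Ekk; rewrite !rr.
- rewrite -sp (partition_big rep (fun i => i \in reps)) /=; last by move=> i _; rewrite inE rep_rep.
  rewrite [RHS]big_enum_val; apply: eq_bigr => k _.
  rewrite -(big_enum_val (fun j => W j *m (W j)^H)) /=.
  by apply: eq_big => [j|j _]; [rewrite inE | have [_ -> _] := HW j].
Qed.

End StarAlgebra.

(** * The sufficiency algebra *)

Section Ext.
Variables (K : comPzRingType) (dE : nat).

Definition ext m n (A : 'M[K]_(m, n)) : 'M[K]_(m * dE, n * dE) := A *t 1%:M.

Lemma extM m n p (A : 'M[K]_(m, n)) (B : 'M[K]_(n, p)) : ext (A *m B) = ext A *m ext B.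
Proof. by rewrite /ext tensmx_mul mulmx1. Qed.

Lemma ext0 m n : ext (0 : 'M[K]_(m, n)) = 0.
Proof. exact: tens0mx. Qed.

Lemma ext1 m : ext (1%:M : 'M[K]_m) = 1%:M.
Proof. exact: tensmx11. Qed.

Lemma extD m n (A B : 'M[K]_(m, n)) : ext (A + B) = ext A + ext B.
Proof. exact: tensmxDl. Qed.

Lemma extZ m n a (A : 'M[K]_(m, n)) : ext (a *: A) = a *: ext A.
Proof. exact: tensmxZl. Qed.

Lemma ext_sum m n (I : Type) (r : seq I) (P : pred I) (F : I -> 'M[K]_(m, n)) :
  ext (\sum_(i <- r | P i) F i) = \sum_(i <- r | P i) ext (F i).
Proof. exact: (big_morph _ (@extD m n) (@ext0 m n)). Qed.

Lemma mxtraceBB n (A B A' B' : 'M[K]_n) :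
  \tr (A - B - (A' - B')) = \tr A - \tr B - (\tr A' - \tr B').
Proof. by rewrite !mxtraceB. Qed.

End Ext.
Arguments ext {K} dE {m n} A.

Lemma ext_adj (R : realType) dE m n (A : 'M[R[i]]_(m, n)) : (ext dE A)^H = ext dE A^H.
Proof. by rewrite /ext adjmx_tens adjmx1. Qed.

Section SufficiencyAlgebra.
Variable R : realType.
Local Notation C := R[i].
Variables (dS dE : nat) (G : 'M[C]_(dS * dE)) (H Hi P : 'M[C]_dS).
Local Notation "[ A ]E" := (ext dE A) (at level 0, A at level 99, format "[ A ]E").
Hypotheses (hG : G^H = G) (hH : H^H = H) (hHi : Hi^H = Hi) (hP : P^H = P).
Hypotheses (HHi : H *m Hi = P) (HiH : Hi *m H = P) (PH : P *m H = H) (HP : H *m P = H).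
Hypotheses (PHi : P *m Hi = Hi) (HiP : Hi *m P = Hi).
Hypotheses (tG : ptrE (G *m G) = H *m H) (PG : [P]E *m G = G).

(** The intertwining form makes closure under products and linear combinations immediate, while the
    equivalent partial-trace form of [sufficientP] is the one visibly stable under adjoints and
    supplied by Petz recovery. Asking [D] to commute with [P], rather than to be supported on it,
    puts 1 in the algebra. *)
Definition sufficient (D : 'M[C]_dS) :=
  P *m D = D *m P /\ [D]E *m G = G *m [Hi *m D *m H]E.

(* Both conditions say that [[D]E *m G - G *m [Hi *m D *m H]E] has zero
   Hilbert-Schmidt norm. *)
Lemma sufficientP D : P *m D = D *m P ->
  (sufficient D <-> ptrE (G *m [D]E *m G) = H *m D *m H).
Proof.
move=> cPD; split=> [[_ e]|eD].
  rewrite -mulmxA e mulmxA ptrE_mulr tG.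
  by rewrite -!mulmxA (mulmxA H Hi) HHi (mulmxA P) cPD -(mulmxA D) PH.
split=> //; apply/subr0_eq/mxtrace_gram_le0.
have cPDH : P *m D^H = D^H *m P by rewrite -{1}hP -adjmxM -cPD adjmxM hP.
have eDH : ptrE (G *m [D^H]E *m G) = H *m D^H *m H.
  transitivity ((H *m D *m H)^H); last by rewrite !adjmxM hH mulmxA.
  by rewrite -eD -ptrE_adj !adjmxM hG ext_adj mulmxA.
have [D' eD'] : exists D', D' = Hi *m D *m H by exists (Hi *m D *m H).
have eD'H : D'^H = H *m D^H *m Hi by rewrite eD' !adjmxM hH hHi mulmxA.
rewrite -eD' adjmxB !adjmxM hG !ext_adj mulmxBl !mulmxBr.
(* Each of the four terms of the expanded norm equals [\tr (H *m H *m (D^H *m D))], with signs that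
   cancel. *)
have t1 : \tr (G *m [D^H]E *m ([D]E *m G)) = \tr (H *m H *m (D^H *m D)).
  by rewrite -tG mxtrace_ptrE_mul -/(ext dE _) extM mulmxA mxtrace_mulC !mulmxA.
have t2 : \tr (G *m [D^H]E *m (G *m [D']E)) = \tr (H *m H *m (D^H *m D)).
  rewrite mulmxA -/(ext dE _) -mxtrace_ptrE_mul eDH eD' !mulmxA.
  rewrite -(mulmxA _ H Hi) HHi -(mulmxA _ P) cPD !mulmxA -(mulmxA _ P H) PH.
  by rewrite mxtrace_mulC !mulmxA.
have t3 : \tr ([D'^H]E *m G *m ([D]E *m G)) = \tr (H *m H *m (D^H *m D)).
  rewrite -mulmxA mxtrace_mulC (mulmxA G) -mxtrace_ptrE_mul eD eD'H mulmxA mxtrace_mulC.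
  rewrite !mulmxA HiH cPD -(mulmxA D P H) PH -!mulmxA mxtrace_mulC !mulmxA.
  by rewrite -(mulmxA _ H).
have t4 : \tr ([D'^H]E *m G *m (G *m [D']E)) = \tr (H *m H *m (D^H *m D)).
  have -> : \tr ([D'^H]E *m G *m (G *m [D']E)) = \tr (G *m G *m [D' *m D'^H]E).
    by rewrite extM !mulmxA [RHS]mxtrace_mulC !mulmxA.
  rewrite -mxtrace_ptrE_mul tG eD'H eD' !mulmxA -(mulmxA _ H Hi) HHi HP mxtrace_mulC.
  by rewrite !mulmxA HiH cPD -(mulmxA D P H) PH -!mulmxA mxtrace_mulC !mulmxA -(mulmxA _ H).
by rewrite mxtraceBB t1 t2 t3 t4 !subrr.
Qed.

Lemma sufficient_commute D : sufficient D -> P *m D = D *m P. Proof. by case. Qed.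

(** Intertwining rewrites [G *m [Hi *m D *m H]E *m G] as [[D]E *m (G *m G)], whose partial trace is
    [D *m H *m H]. *)
Lemma sufficient_flat D : sufficient D -> sufficient (Hi *m D *m H).
Proof.
move=> sD; have [cPD eD] := sD.
have cP : P *m (Hi *m D *m H) = Hi *m D *m H *m P by rewrite !mulmxA PHi -(mulmxA _ H) HP.
apply/(sufficientP cP); rewrite -eD -(mulmxA _ G G) /ext ptrE_mull tG !mulmxA HHi cPD.
by rewrite -(mulmxA D P H) PH.
Qed.

Lemma sufficient_adj D : sufficient D -> sufficient D^H.
Proof.
move=> sD; have [cPD _] := sD.
have cPDH : P *m D^H = D^H *m P by rewrite -{1}hP -adjmxM -cPD adjmxM hP.
apply/(sufficientP cPDH); move/(sufficientP cPD): sD => eD.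
transitivity ((H *m D *m H)^H); last by rewrite !adjmxM hH mulmxA.
by rewrite -eD -ptrE_adj !adjmxM hG ext_adj mulmxA.
Qed.

Lemma sufficient_sharp D : sufficient D -> sufficient (H *m D *m Hi).
Proof.
move=> sD; have -> : H *m D *m Hi = (Hi *m D^H *m H)^H.
  by rewrite !adjmxM hH hHi adjmxK mulmxA.
exact/sufficient_adj/sufficient_flat/sufficient_adj.
Qed.

Lemma sufficient_sharpE D : sufficient D -> G *m [D]E = [H *m D *m Hi]E *m G.
Proof.
move=> /sufficient_adj[_ /(congr1 (@adjmx R _ _))].
by rewrite !adjmxM !ext_adj !adjmxM hG hH hHi adjmxK mulmxA.
Qed.

Lemma sufficient1 : sufficient 1%:M.
Proof.
split; first by rewrite mulmx1 mul1mx.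
by rewrite mulmx1 HiH ext1 mul1mx -[G in RHS]hG -[P]hP -ext_adj -adjmxM PG hG.
Qed.

Lemma sufficientM D D' : sufficient D -> sufficient D' -> sufficient (D *m D').
Proof.
move=> [cD eD] [cD' eD']; split; first by rewrite mulmxA cD -!mulmxA cD'.
rewrite extM -(mulmxA [D]E) eD' (mulmxA [D]E G) eD -(mulmxA G) -extM; congr (_ *m ext _ _).
by rewrite !mulmxA -(mulmxA _ H) HHi -(mulmxA _ P) cD' !mulmxA -(mulmxA _ P) PH.
Qed.

Lemma sufficientL c D D' : sufficient D -> sufficient D' -> sufficient (c *: D + D').
Proof.
move=> [cD eD] [cD' eD']; split.
  by rewrite mulmxDr mulmxDl -scalemxAr -scalemxAl cD cD'.
rewrite extD extZ mulmxDl -scalemxAl eD eD' mulmxDr mulmxDl -scalemxAr -scalemxAl.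
by rewrite extD extZ mulmxDr -scalemxAr.
Qed.

Lemma sufficient_petz D : P *m D = D -> D *m P = D ->
  ptrE (G *m [D]E *m G) = H *m D *m H -> sufficient D.
Proof. by move=> PD DP e; apply/sufficientP => //; rewrite PD DP. Qed.

(** With [H] the square root of w_S this is conjugation by w_S, the modular automorphism at
    imaginary time. On matrices commuting with [P] it is multiplicative, but it need not commute
    with the adjoint. *)
Definition modular x := H *m (H *m x *m Hi) *m Hi.

Lemma sufficient_modular D : sufficient D -> sufficient (modular D).
Proof. by move=> sD; apply/sufficient_sharp/sufficient_sharp. Qed.

Lemma modularE D : sufficient D -> G *m G *m [D]E = [modular D]E *m (G *m G).
Proof.
move=> sD; rewrite -(mulmxA G G) (sufficient_sharpE sD) (mulmxA G).
by rewrite (sufficient_sharpE (sufficient_sharp sD)) -(mulmxA _ G G).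
Qed.

Lemma modularM x y : P *m y = y *m P -> modular (x *m y) = modular x *m modular y.
Proof.
move=> cy; rewrite /modular !mulmxA.
rewrite -(mulmxA _ Hi H) HiH -(mulmxA _ Hi P) HiP -(mulmxA _ Hi H) HiH.
by rewrite -(mulmxA _ P y) cy !mulmxA -(mulmxA _ P Hi) PHi.
Qed.

(* A minimal projection [p] and the (non-orthogonal) projection [modular p]
   generate each other: [modular p *m p *m modular p] is a multiple of
   [modular p], nonzero unless [modular p] is. *)
Lemma modular_minimal p : minimal_projection sufficient p ->
  exists u, sufficient u /\ u *m p *m modular p = modular p.
Proof.
move=> [sp [hp pp] _ minp].
have smp := sufficient_modular sp; have [cp _] := sp.
have mm : modular p *m modular p = modular p by rewrite -(modularM p cp) pp.
(* The product [modular p *m p *m modular p] contains this twice-flattened [p] between two copies of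
   [p], so minimality applies to it. *)
have [c ec] := minp (Hi *m (Hi *m p *m H) *m H) (sufficient_flat (sufficient_flat sp)).
have emp : modular p *m p *m modular p = c *: modular p.
  transitivity (H *m (H *m (p *m (Hi *m (Hi *m p *m H) *m H) *m p) *m Hi) *m Hi).
    by rewrite /modular -!mulmxA.
  by rewrite ec -!(scalemxAr, scalemxAl).
have [c0|nc] := eqVneq c 0; last first.
  exists (c^-1 *: modular p); split.
    have := sufficientL c^-1 smp (sufficientL (-1) sufficient1 sufficient1).
    by rewrite scaleN1r addNr addr0.
  by rewrite -!scalemxAl emp scalerA mulVf // scale1r.
(* If [c] is 0 then [modular p] is 0: the squared norm of [H *m p *m Hi] is [\tr (p *m modular p)],
   which is the trace of [modular p *m p *m modular p]. *)
exists 1%:M; split; first exact: sufficient1.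
suff -> : modular p = 0 by rewrite mulmx0.
suff z : H *m p *m Hi = 0 by rewrite /modular z mulmx0 mul0mx.
apply: mxtrace_gram_le0; rewrite !adjmxM hH hHi hp.
have -> : Hi *m (p *m H) *m (H *m p *m Hi) = Hi *m (p *m (H *m (H *m p *m Hi))).
  by rewrite -!mulmxA.
rewrite mxtrace_mulC -!mulmxA.
have -> : p *m (H *m (H *m (p *m (Hi *m Hi)))) = p *m modular p by rewrite /modular -!mulmxA.
by rewrite -mm mulmxA mxtrace_mulC mulmxA emp c0 scale0r mxtrace0.
Qed.

(** [y] crosses [G *m G] as [modular y], which factors through [u *m p *m modular p]; the last
    factor crosses back as [p]. Hence [a] is [x^H *m E *m modular y *m u]. *)
Lemma sufficient_block p (E x y : 'M[C]_dS) : minimal_projection sufficient p ->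
  sufficient E -> sufficient x -> sufficient y -> y *m p = y ->
  exists2 a, sufficient a &
    [x^H]E *m ([E]E *m (G *m G)) *m [y]E = [a *m p]E *m (G *m G) *m [p]E.
Proof.
move=> mp sE sx sy yp; have [u [su eu]] := modular_minimal mp; have [sp _ _ _] := mp.
have smy := sufficient_modular sy.
have emy : modular y *m (u *m p *m modular p) = modular y.
  by rewrite eu -(modularM y (sufficient_commute sp)) yp.
have := modularE sy; have := modularE sp.
move: (G *m G) (modular y) (modular p) smy emy => W my mp' smy emy eWp eWy {eu mp}.
exists (x^H *m E *m my *m u).
  apply: sufficientM su; apply: sufficientM smy.
  exact: (sufficientM (sufficient_adj sx) sE).
have -> : [x^H]E *m ([E]E *m W) *m [y]E = [x^H]E *m [E]E *m (W *m [y]E).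
  by rewrite !mulmxA.
rewrite eWy -[RHS]mulmxA eWp [LHS]mulmxA [RHS]mulmxA -!extM.
by rewrite -[in LHS]emy !mulmxA.
Qed.

End SufficiencyAlgebra.

(** * A criterion for Markov states *)

Section Cast.
Variable R : realType.
Local Notation C := R[i].

Lemma psd_castmx m m' (e : m = m') (A : 'M[C]_m) : psd (castmx (e, e) A) <-> psd A.
Proof. by case: m' / e; rewrite castmx_id. Qed.

Lemma mxtrace_castmx m m' (e : m = m') (A : 'M[C]_m) : \tr (castmx (e, e) A) = \tr A.
Proof. by case: m' / e; rewrite castmx_id. Qed.

Lemma castmx_sum m m' (e : m = m') (I : finType) (F : I -> 'M[C]_m) :
  castmx (e, e) (\sum_i F i) = \sum_i castmx (e, e) (F i).
Proof. by case: m' / e; rewrite castmx_id; apply: eq_bigr => i _; rewrite castmx_id. Qed.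

Lemma castmxZ m m' (e : m = m') a (A : 'M[C]_m) :
  castmx (e, e) (a *: A) = a *: castmx (e, e) A.
Proof. by case: m' / e; rewrite !castmx_id. Qed.

End Cast.

Section MarkovCriterion.
Variable R : realType.
Local Notation C := R[i].

Lemma density_exists n : (0 < n)%N -> exists s : 'M[C]_n, density s.
Proof.
case: n => // n _; exists ((delta_mx 0 0 : 'M[C]_n.+1) *m (delta_mx 0 0)^H); split.
  by rewrite -{1}[delta_mx 0 0]adjmxK; apply: psd_gram.
rewrite adjmx_delta mul_delta_mx.
by have := mxtrace_delta_mul 0 0 (1%:M : 'M[C]_n.+1); rewrite mul1mx mxE.
Qed.

Lemma mxtrace_isometry m n (N : 'M[C]_(n, m)) (B : 'M[C]_m) :
  N^H *m N = 1%:M -> \tr (N *m B *m N^H) = \tr B.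
Proof. by move=> NN; rewrite mxtrace_mulC mulmxA NN mul1mx. Qed.

(** Each diagonal block need only be a product with [T k] positive: positivity of [w] passes to the
    block and then to [X k], and the weights are the traces of the blocks. *)
Lemma markov_criterion dR dS dE (w : 'M[C]_(dR * (dS * dE))) K (aL aR : 'I_K -> nat)
    (J : forall k : 'I_K, 'M[C]_(dS, aL k * aR k))
    (X : forall k : 'I_K, 'M[C]_(dR * aL k)) (T : forall k : 'I_K, 'M[C]_(aR k * dE)) :
  (0 < dR)%N -> (0 < dE)%N -> (forall k, (0 < aL k)%N /\ (0 < aR k)%N) ->
  density w ->
  (forall k, (J k)^H *m J k = 1%:M) -> (forall k l, k != l -> (J k)^H *m J l = 0) ->
  \sum_k J k *m (J k)^H = 1%:M ->
  (forall k, psd (T k)) ->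
  (forall k l, k != l ->
     ((1%:M : 'M[C]_dR) *t ext dE (J k))^H *m w *m ((1%:M : 'M[C]_dR) *t ext dE (J l)) = 0) ->
  (forall k, ((1%:M : 'M[C]_dR) *t ext dE (J k))^H *m w *m
             ((1%:M : 'M[C]_dR) *t ext dE (J k)) =
     castmx (tens_assoc_eq dR (aL k) (aR k) dE, tens_assoc_eq dR (aL k) (aR k) dE)
       (X k *t T k)) ->
  markov_state w.
Proof.
move=> dR0 dE0 a0 [pw trw] JJ JJ0 sJ pT off diag.
pose N k := (1%:M : 'M[C]_dR) *t ext dE (J k).
pose cst k : 'M[C]_(dR * aL k * (aR k * dE)) -> 'M[C]_(dR * (aL k * aR k * dE)) := castmx (tens_assoc_eq dR (aL k) (aR k) dE, tens_assoc_eq dR (aL k) (aR k) dE).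
have NN k : (N k)^H *m N k = 1%:M.
  by rewrite /N adjmx_tens adjmx1 ext_adj tensmx_mul mulmx1 -extM JJ ext1 tensmx11.
have sN : \sum_k N k *m (N k)^H = 1%:M.
  rewrite -[RHS]tensmx11 -ext1 -sJ ext_sum.
  rewrite (big_morph (tensmx (1%:M : 'M[C]_dR)) (id1 := 0) (op1 := +%R)) ?tensmx0 //.
    apply: eq_bigr => k _.
    by rewrite /N adjmx_tens adjmx1 ext_adj tensmx_mul mulmx1 -extM.
  by move=> A B; apply/matrixP=> i j; rewrite !mxE mulrDr.
have ew : w = \sum_k N k *m cst k (X k *t T k) *m (N k)^H.
  rewrite -[LHS]mul1mx -[LHS]mulmx1 -sN mulmx_suml mulmx_suml; apply: eq_bigr => k _.
  rewrite mulmx_sumr (bigD1 k) //= big1 ?addr0 => [|l nl].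
    by rewrite /cst -diag !mulmxA.
  have := off k l; rewrite eq_sym => /(_ nl) e.
  transitivity (N k *m ((N k)^H *m w *m N l) *m (N l)^H); first by rewrite !mulmxA.
  by rewrite e mulmx0 mul0mx.
have pB k : psd (X k *t T k).
  by apply/(psd_castmx (tens_assoc_eq dR (aL k) (aR k) dE)); rewrite -diag; apply: psd_conj.
have trB k : \tr (cst k (X k *t T k)) = \tr (X k) * \tr (T k).
  by rewrite mxtrace_castmx mxtrace_tens.
pose lam k := \tr (X k) * \tr (T k).
have lam0 k : 0 <= lam k by rewrite /lam -mxtrace_tens; apply: psd_tr_ge0.
have dens k : exists sLE : 'M[C]_(dR * aL k) * 'M[C]_(aR k * dE),
    [/\ density sLE.1, density sLE.2 & X k *t T k = lam k *: (sLE.1 *t sLE.2)].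
  have [aL0 aR0] := a0 k.
  (* A block of weight 0 vanishes but still has to display density matrices; positive dimensions
     provide arbitrary ones. *)
  have [l0|nl] := eqVneq (lam k) 0.
    have [s1 d1] : exists s : 'M[C]_(dR * aL k), density s.
      by apply: density_exists; rewrite muln_gt0 dR0.
    have [s2 d2] : exists s : 'M[C]_(aR k * dE), density s.
      by apply: density_exists; rewrite muln_gt0 aR0.
    exists (s1, s2); split=> //=; rewrite l0 scale0r.
    by apply: (psd_tr_le0 (pB k)); rewrite mxtrace_tens -/(lam k) l0.
  have /andP[nX nT] : (\tr (X k) != 0) && (\tr (T k) != 0) by rewrite -negb_or -mulf_eq0.
  exists ((\tr (X k))^-1 *: X k, (\tr (T k))^-1 *: T k); split => /=.
  - apply: psd_normalize_density => //.
    (* Only the product is known to be positive; tracing out its second factor recovers [X k] up to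
       a positive scalar. *)
    have -> : X k = (\tr (T k))^-1 *: ptrE (X k *t T k).
      by rewrite ptrE_tens scalerA mulVf ?scale1r.
    by apply: psdZ; [rewrite invr_ge0; apply: psd_tr_ge0 | apply: ptrE_positive].
  - exact: psd_normalize_density.
  - rewrite tensmxZl tensmxZr /lam -scalerA (scalerA (\tr (T k))) (mulrC (\tr (T k))).
    by rewrite -scalerA scalerA mulfV // scale1r scalerA mulfV // scale1r.
have {}dens := fun k => cid (dens k).
exists K, aL, aR, J, lam, (fun k => (sval (dens k)).1), (fun k => (sval (dens k)).2).
split.
- by split.
- by [].
- split=> //; rewrite -trw ew raddf_sum; apply: eq_bigr => k _ /=.
  by rewrite (mxtrace_isometry _ (NN k)) trB.
- by move=> k; case: (dens k) => [[s1 s2] []].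
rewrite {1}ew; apply: eq_bigr => k _.
case: (dens k) => [[s1 s2] [_ _ /= ->]].
by rewrite /cst castmxZ -scalemxAr -scalemxAl.
Qed.

End MarkovCriterion.

(** * Isometries and selection of blocks *)

Section Isometries.
Variable R : realType.
Local Notation C := R[i].

Lemma projection_range n (p : 'M[C]_n) : projection p -> p <> 0 ->
  exists r (Q : 'M[C]_(n, r)), [/\ (0 < r)%N, Q^H *m Q = 1%:M & Q *m Q^H = p].
Proof.
move=> [hp pp] np; have [U [d [UU UU' ep]]] := hermitian_spectral hp.
have dd i : d 0 i * d 0 i = d 0 i.
  have := pp; rewrite ep conj_diag_mul // => /(congr1 (fun x => U *m x *m U^H)).
  rewrite !mulmxA UU !mul1mx -!mulmxA UU !mulmx1 => /matrixP/(_ i i).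
  by rewrite !mxE eqxx !mulr1n.
pose S := [set i | d 0 i != 0].
pose Q : 'M[C]_(n, #|S|) := \matrix_(i, k) U^H i (enum_val k).
have QQ : Q *m Q^H = p.
  rewrite ep; apply/matrixP=> i j; rewrite mxE.
  transitivity (\sum_(k in S) U^H i k * U k j).
    rewrite [RHS]big_enum_val; apply: eq_bigr => k _.
    by rewrite !mxE conjCK.
  rewrite mxE big_mkcond; apply: eq_bigr => k _.
  rewrite mul_mx_diag [in RHS]mxE inE.
  have [->|nk] := eqVneq (d 0 k) 0; first by rewrite mulr0 mul0r.
  suff -> : d 0 k = 1 by rewrite mulr1.
  by apply: (mulfI nk); rewrite dd mulr1.
exists #|S|, Q; split => //.
  rewrite lt0n; apply/eqP=> S0; apply: np; rewrite -QQ; apply/matrixP=> i j.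
  by rewrite !mxE big1 // => k; have : (k < 0)%N by rewrite -[X in (_ < X)%N]S0.
apply/matrixP=> k l; rewrite mxE.
have := UU => /matrixP/(_ (enum_val k) (enum_val l)); rewrite !mxE (inj_eq enum_val_inj) => <-.
by apply: eq_bigr => i _; rewrite !mxE conjCK.
Qed.

Section Selection.
Variables (d r : nat).

(* [sel l] maps [l' *t x] to [x] when [l' = l] and to [0] otherwise. *)
Definition sel (l : 'I_d) : 'M[C]_(r, d * r) :=
  \matrix_(x, k) ((mxtens_unindex k == (l, x))%:R).

Lemma sel_mul m (l : 'I_d) (A : 'M[C]_(m, r)) i l' x :
  (A *m sel l) i (mxtens_index (l', x)) = (l' == l)%:R * A i x.
Proof.
rewrite mxE (bigD1 x) //= big1 ?addr0 => [|y /negPf ny].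
  by rewrite mxE mxtens_indexK xpair_eqE eqxx andbT mulrC.
by rewrite mxE mxtens_indexK xpair_eqE (eq_sym x) ny andbF mulr0.
Qed.

Lemma sel_orth l l' : sel l *m (sel l')^H = (l == l')%:R *: 1%:M.
Proof.
apply/matrixP=> x y; rewrite mxE (bigD1 (mxtens_index (l, x))) //= big1 ?addr0 => [|k nk].
  rewrite !mxE mxtens_indexK eqxx mul1r rmorph_nat xpair_eqE.
  by rewrite -natrM mulnb.
rewrite [X in X * _]mxE; case: eqP => [ek|]; last by rewrite mul0r.
by rewrite -ek mxtens_unindexK eqxx in nk.
Qed.

Lemma sel_resolution : \sum_l (sel l)^H *m sel l = 1%:M.
Proof.
apply: matrix_tensP => l x l' y; rewrite summxE (bigD1 l') //= big1 ?addr0 => [|k nk].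
  rewrite sel_mul eqxx mul1r !mxE mxtens_indexK rmorph_nat.
  by rewrite (can_eq (@mxtens_indexK _ _)).
by rewrite sel_mul eq_sym (negPf nk) mul0r.
Qed.

(** Reassociating the tensor factors moves the multiplicity labels [l], [l'] from the system to the
    side of [X], where they appear as a matrix unit. *)
Lemma sel_conj dE dR (e : (dR * d * (r * dE) = dR * (d * r * dE))%N)
    (X : 'M[C]_dR) l l' (T : 'M[C]_(r * dE)) :
  X *t ((ext dE (sel l))^H *m T *m ext dE (sel l')) =
  castmx (e, e) ((X *t delta_mx l l') *t T).
Proof.
apply: matrix_tensP => a i b j.
case: (mxtens_indexP i) => k x; case: (mxtens_indexP k) => l1 y {i k}.
case: (mxtens_indexP j) => k x'; case: (mxtens_indexP k) => l2 y' {j k}.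
rewrite castmxE.
have ce c l3 z t : cast_ord (esym e) (mxtens_index (c, mxtens_index (mxtens_index (l3, z), t))) =
    mxtens_index (mxtens_index (c, l3), mxtens_index (z, t)).
  by apply: val_inj => /=; rewrite !mulnDl !mulnA !addnA.
rewrite !ce !tensmxE -mulrA; congr (_ * _).
have extsel (n : nat) (A : 'M[C]_(n, r * dE)) m0 l0 l3 z t :
    (A *m ext dE (sel l0)) m0 (mxtens_index (mxtens_index (l3, z), t)) =
    (l3 == l0)%:R * A m0 (mxtens_index (z, t)).
  rewrite mxE sum_mxtens (bigD1 z) //= [X in _ + X]big1 ?addr0 => [|z' /negPf nz].
    rewrite (bigD1 t) //= big1 ?addr0 => [|t' /negPf nt].
      by rewrite tensmxE !mxE mxtens_indexK xpair_eqE !eqxx andbT mulr1 mulrC.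
    by rewrite tensmxE [X in _ * (_ * X)]mxE nt !mulr0.
  rewrite big1 // => t' _.
  by rewrite tensmxE [X in _ * (X * _)]mxE mxtens_indexK xpair_eqE (eq_sym z) nz andbF mul0r mulr0.
rewrite extsel -[_ *m T]adjmxK adjmxM adjmxK adjmxE extsel rmorphM rmorph_nat adjmxE /= conjCK.
by rewrite mulrA -natrM mulnb mxE andbC.
Qed.

End Selection.
End Isometries.

Section Reference.
Variable R : realType.
Local Notation C := R[i].

Lemma tensmx_sumr (K : comPzRingType) m n p q (A : 'M[K]_(m, n)) (I : finType)
    (F : I -> 'M[K]_(p, q)) : A *t (\sum_i F i) = \sum_i (A *t F i).
Proof.
apply: (big_morph (tensmx A)); last exact: tensmx0.
by move=> X Y; apply/matrixP=> i j; rewrite !mxE mulrDr.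
Qed.

Lemma tensmx_suml (K : comPzRingType) m n p q (A : 'M[K]_(m, n)) (I : finType)
    (F : I -> 'M[K]_(p, q)) : (\sum_i F i) *t A = \sum_i (F i *t A).
Proof.
apply: (big_morph (fun X => X *t A)); last exact: tens0mx.
by move=> X Y; apply: tensmxDl.
Qed.

Lemma mulmx_conj2Z (K : comPzRingType) m n p q r (A : 'M[K]_(m, n)) (B : 'M[K]_(n, p))
    (D : 'M[K]_p) (B' : 'M[K]_(p, q)) (A' : 'M[K]_(q, r)) c :
  A *m (B *m (c *: D) *m B') *m A' = c *: (A *m (B *m D *m B') *m A').
Proof. by rewrite -scalemxAr -scalemxAl -scalemxAr -scalemxAl. Qed.

Lemma density_omega_ref dS dE m (rho : nat -> 'M[C]_(dS * dE)) : (0 < m)%N ->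
  (forall i, (i < m)%N -> density (rho i)) -> density (omega_ref m rho).
Proof.
move=> m0 dr; split.
  apply: psd_sum => l _; apply: psdZ; first by rewrite invr_ge0 ler0n.
  have [r [pr er]] := psd_sqrt (dr l (ltn_ord l)).1.
  have := psd_gram (delta_mx l l *t r : 'M[C]_(m * (dS * dE))).
  by rewrite adjmx_tens tensmx_mul adjmx_delta mul_delta_mx (psd_adj pr) er.
rewrite raddf_sum /= (eq_bigr (fun=> (m%:R)^-1)) => [|l _].
  by rewrite sumr_const card_ord -[LHS]mulr_natr mulVf // pnatr_eq0 -lt0n.
rewrite mxtraceZ mxtrace_tens (dr l (ltn_ord l)).2 mulr1.
have -> : \tr (delta_mx l l : 'M[C]_m) = 1 by rewrite -[delta_mx l l]mul1mx mxtrace_delta_mul mxE eqxx.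
by rewrite mulr1.
Qed.

Lemma omega_ref_conj dS dE m (rho : nat -> 'M[C]_(dS * dE)) p q
    (A : 'M[C]_(dS * dE, p)) (B : 'M[C]_(dS * dE, q)) :
  ((1%:M : 'M[C]_m) *t A)^H *m omega_ref m rho *m ((1%:M : 'M[C]_m) *t B) =
  \sum_(l < m) (m%:R)^-1 *: (delta_mx l l *t (A^H *m rho l *m B)).
Proof.
rewrite /omega_ref mulmx_sumr mulmx_suml; apply: eq_bigr => l _.
rewrite -scalemxAr -scalemxAl adjmx_tens adjmx1 !tensmx_mul.
by rewrite mul1mx mulmx1.
Qed.

End Reference.

(** * Markov structure from the sufficiency algebra *)

Section MarkovOfSufficient.
Variable R : realType.
Local Notation C := R[i].
Variables (dS dE : nat) (G : 'M[C]_(dS * dE)) (H Hi P : 'M[C]_dS).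
Local Notation "[ A ]E" := (ext dE A) (at level 0, A at level 99, format "[ A ]E").
Hypotheses (hG : G^H = G) (hH : H^H = H) (hHi : Hi^H = Hi) (hP : P^H = P).
Hypotheses (HHi : H *m Hi = P) (HiH : Hi *m H = P) (PH : P *m H = H) (HP : H *m P = H).
Hypotheses (PHi : P *m Hi = Hi) (HiP : Hi *m P = Hi).
Hypotheses (tG : ptrE (G *m G) = H *m H) (PG : [P]E *m G = G).
Let suff := @sufficient R dS dE G H Hi P.

Lemma sufficient_corner p q (E x y : 'M[C]_dS) : minimal_projection suff p ->
  minimal_projection suff q -> suff E -> suff x -> suff y ->
  x *m q = x -> y *m p = y ->
  exists2 a, suff a & [x]E^H *m ([E]E *m (G *m G)) *m [y]E =
                      [q *m a *m p]E *m (G *m G) *m [p]E.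
Proof.
move=> mp [_ [hq _] _ _] sE sx sy xq yp.
have [a sa ea] := sufficient_block hG hH hHi hP HHi HiH PH HP PHi HiP tG PG mp sE sx sy yp.
exists a; first exact: sa.
have -> : [q *m a *m p]E = [q]E *m [a *m p]E by rewrite -extM mulmxA.
have -> : [x]E^H = [q]E *m [x^H]E by rewrite -extM -{1}hq -adjmxM xq ext_adj.
move: (G *m G) ea => W ea.
transitivity ([q]E *m ([x^H]E *m ([E]E *m W) *m [y]E)).
  by rewrite !mulmxA.
by rewrite ea !mulmxA.
Qed.

(** In the class [k] the labels of the matrix units form the left factor, correlated with R, and the
    range of [p k] forms the right factor, correlated with E. *)
Lemma markov_of_sufficient m (rho : nat -> 'M[C]_(dS * dE)) : (0 < m)%N -> (0 < dE)%N ->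
  (forall i, (i < m)%N -> density (rho i)) ->
  (forall i, (i < m)%N -> exists2 E, suff E & rho i = [E]E *m (G *m G)) ->
  markov_state (omega_ref m rho).
Proof.
move=> m0 dE0 dr sr.
have A1 : suff 1%:M by apply: sufficient1.
have AM x y : suff x -> suff y -> suff (x *m y) by apply: sufficientM.
have AL c x y : suff x -> suff y -> suff (c *: x + y) by apply: sufficientL.
have AH x : suff x -> suff x^H by apply: sufficient_adj.
have [K [d [V [p [d0 AV [VV [VV1 VV2] pp sV]]]]]] := matrix_units A1 AM AL AH.
have ex k : exists rQ : {r : nat & 'M[C]_(dS, r)},
    [/\ (0 < projT1 rQ)%N, (projT2 rQ)^H *m projT2 rQ = 1%:M &
        projT2 rQ *m (projT2 rQ)^H = p k].
  have [_ [_ pk nk _]] := d0 k; have [r [Q [r0 Q1 Q2]]] := projection_range pk nk.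
  by exists (existT _ r Q).
have [rQ HrQ] := boolp.choice ex.
pose r k := projT1 (rQ k); pose Q k : 'M[C]_(dS, r k) := projT2 (rQ k).
have r0 k : (0 < r k)%N by case: (HrQ k).
have Q1 k : (Q k)^H *m Q k = 1%:M by case: (HrQ k).
have Q2 k : Q k *m (Q k)^H = p k by case: (HrQ k).
move: r Q r0 Q1 Q2 => r Q r0 Q1 Q2 {HrQ rQ ex}.
have pQ k : (Q k)^H *m p k = (Q k)^H by rewrite -Q2 mulmxA Q1 mul1mx.
have Qp k : p k *m Q k = Q k by rewrite -Q2 -mulmxA Q1 mulmx1.
(* [J k] sends the basis vector [l] tensored with [x] to [V k l *m Q k *m x]. *)
have [J eJ] : exists J : forall k, 'M[C]_(dS, d k * r k),
    forall k, J k = \sum_l V k l *m Q k *m sel R (r k) l.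
  by exists (fun k => \sum_l V k l *m Q k *m sel R (r k) l).
have JJ k l : (J k)^H *m J l =
    \sum_a \sum_b (sel R (r k) a)^H *m ((Q k)^H *m ((V k a)^H *m V l b) *m Q l) *m sel R (r l) b.
  rewrite !eJ adjmx_sum mulmx_suml; apply: eq_bigr => a _.
  by rewrite mulmx_sumr; apply: eq_bigr => b _; rewrite !adjmxM !mulmxA.
(* All dependence on [i], [l], [l'] is confined to a scalar because the corner at [p k] is
   one-dimensional; this is what makes the block a product. *)
have cf (i : 'I_m) k l l' : exists c, [V k l]E^H *m rho i *m [V k l']E =
    c *: ([p k]E *m (G *m G) *m [p k]E).
  have [E sE ->] := sr i (ltn_ord i).
  have [_ mpk] := d0 k; have [AV1 Vp1] := AV k l; have [AV2 Vp2] := AV k l'.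
  have [a sa ->] := sufficient_corner mpk mpk sE AV1 AV2 Vp1 Vp2.
  have [_ _ _ /(_ a sa)[c ->]] := mpk.
  by exists c; rewrite extZ -!scalemxAl.
have {}cf := fun i k l l' => cid (cf i k l l').
pose c i k l l' := sval (cf i k l l').
have cE (i : 'I_m) k l l' : [V k l]E^H *m rho i *m [V k l']E =
    c i k l l' *: ([p k]E *m (G *m G) *m [p k]E) by rewrite /c; case: (cf i k l l').
move: c cE => c cE {cf}.
pose T k := [Q k]E^H *m (G *m G) *m [Q k]E.
pose X k := \sum_(i < m) (m%:R)^-1 *:
  \sum_a \sum_b c i k a b *: ((delta_mx i i : 'M[C]_m) *t (delta_mx a b : 'M[C]_(d k))).
have Jrho (i : 'I_m) k l : [J k]E^H *m rho i *m [J l]E = \sum_a \sum_b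
    [sel R (r k) a]E^H *m ([Q k]E^H *m ([V k a]E^H *m rho i *m [V l b]E) *m [Q l]E)
      *m [sel R (r l) b]E.
  rewrite !eJ !ext_sum adjmx_sum !mulmx_suml; apply: eq_bigr => a _.
  rewrite mulmx_sumr; apply: eq_bigr => b _.
  by rewrite !extM !adjmxM !mulmxA.
apply: (@markov_criterion _ _ _ _ _ K d r J X T) => //.
- by move=> k; have [] := d0 k.
- exact: density_omega_ref.
- move=> k; rewrite JJ -[RHS](sel_resolution R (d k) (r k)); apply: eq_bigr => a _.
  rewrite (bigD1 a) //= big1 ?addr0 => [|b nb].
    by rewrite VV pQ Q1 mulmx1.
  by rewrite VV1 1?eq_sym // mulmx0 mul0mx mulmx0 mul0mx.
- move=> k l nkl; rewrite JJ big1 // => a _; rewrite big1 // => b _.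
  by rewrite VV2 // mulmx0 mul0mx mulmx0 mul0mx.
- rewrite -[RHS]sV; apply: eq_bigr => k _.
  rewrite eJ adjmx_sum mulmx_suml; apply: eq_bigr => a _.
  rewrite mulmx_sumr (bigD1 a) //= big1 ?addr0 => [|b nb].
    rewrite !adjmxM !mulmxA -(mulmxA _ (sel _ _ a)) sel_orth eqxx scale1r mulmx1.
    by rewrite -(mulmxA _ (Q k)) Q2; have [_ ->] := AV k a.
  rewrite !adjmxM !mulmxA -(mulmxA _ (sel _ _ a)) sel_orth eq_sym (negPf nb) scale0r.
  by rewrite mulmx0 !mul0mx.
- by move=> k; apply: psd_conj; rewrite -{1}hG; apply: psd_gram.
(* Between inequivalent classes the corner [p k *m x *m p l] is zero, so the coherences vanish. *)
- move=> k l nkl; rewrite omega_ref_conj big1 // => i _.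
  suff -> : [J k]E^H *m rho i *m [J l]E = 0 by rewrite tensmx0 scaler0.
  rewrite Jrho big1 // => a _; rewrite big1 // => b _.
  have [E sE ->] := sr i (ltn_ord i).
  have [_ mpk] := d0 k; have [_ mpl] := d0 l.
  have [AV1 Vp1] := AV k a; have [AV2 Vp2] := AV l b.
  have [x sx ->] := sufficient_corner mpl mpk sE AV1 AV2 Vp1 Vp2.
  by rewrite pp // ext0 !mul0mx mulmx0 !mul0mx mulmx0 mul0mx.
- move=> k; rewrite omega_ref_conj /X tensmx_suml castmx_sum; apply: eq_bigr => i _.
  rewrite tensmxZl castmxZ; congr (_ *: _).
  rewrite Jrho tensmx_sumr tensmx_suml castmx_sum; apply: eq_bigr => a _.
  rewrite tensmx_sumr tensmx_suml castmx_sum; apply: eq_bigr => b _.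
  rewrite cE tensmxZl castmxZ -sel_conj -tensmxZr; congr (_ *t _).
  have eT : [Q k]E^H *m ([p k]E *m (G *m G) *m [p k]E) *m [Q k]E = T k.
    rewrite /T; move: (G *m G) => W.
    transitivity ([Q k]E^H *m [p k]E *m W *m ([p k]E *m [Q k]E)); first by rewrite !mulmxA.
    by rewrite ext_adj -!extM pQ Qp.
  by rewrite mulmx_conj2Z eT.
Qed.

End MarkovOfSufficient.

(** * The assignment map *)

Lemma nth_map_iota (T : nmodType) (s : nat -> T) N i : (i < N)%N ->
  [seq s j | j <- iota 0 N]`_i = s i.
Proof. by move=> iN; rewrite (nth_map 0%N) ?size_iota // nth_iota. Qed.

Section Assembly.
Variable R : realType.
Local Notation C := R[i].

Lemma span_combination m n p q (f : 'M[C]_(m, n) -> 'M[C]_(p, q)) (N : nat)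
    (s : nat -> 'M[C]_(m, n)) (t : nat -> 'M[C]_(p, q)) Y :
  linear f -> (forall i, (i < N)%N -> f (s i) = t i) ->
  Y \in <<[seq s i | i <- iota 0 N]>>%VS ->
  exists c : 'I_N -> C, Y = \sum_i c i *: s i /\ f Y = \sum_i c i *: t i.
Proof.
move=> lf fst Ys.
have [c eY] : exists c : 'I_N -> C, Y = \sum_i c i *: s i.
  have sz : size [seq s i | i <- iota 0 N] == N by rewrite size_map size_iota.
  exists (fun i => coord (Tuple sz) i Y).
  rewrite [LHS](coord_span (X := Tuple sz)) //; apply: eq_bigr => i _.
  by rewrite nth_map_iota.
exists c; split=> //; rewrite {1}eY (linear_fsum lf); apply: eq_bigr => i _.
by rewrite (linear_fZ lf) fst.
Qed.

Lemma inSpanSet_combination n (S : 'M[C]_n -> Prop) N (rho : nat -> 'M[C]_n) (c : 'I_N -> C) :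
  (forall i, (i < N)%N -> S (rho i)) -> inSpanSet S (\sum_i c i *: rho i).
Proof.
move=> Sr; exists [seq rho i | i <- iota 0 N]; split.
  by move=> Y /mapP[j]; rewrite mem_iota => /Sr Sj ->.
apply: rpred_sum => i _; apply: rpredZ; apply: memv_span.
by apply/mapP; exists (nat_of_ord i); rewrite ?mem_iota ?ltn_ord.
Qed.

Lemma ext_linear m n dE : linear (@ext C dE m n).
Proof. by move=> a X Y; rewrite extD extZ. Qed.

(** The weight 1/m turns into the domination constant [m] used as [c] in the recovery. *)
Lemma psd_average n m (rho : nat -> 'M[C]_n) (i : 'I_m) :
  (forall j, (j < m)%N -> psd (rho j)) ->
  psd (m%:R *: (\sum_(j < m) (m%:R)^-1 *: rho j) - rho i).
Proof.
move=> pr; have -> : m%:R *: (\sum_(j < m) (m%:R)^-1 *: rho j) - rho i =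
    \sum_(j < m | j != i) rho j.
  rewrite scaler_sumr (eq_bigr (fun j : 'I_m => rho j)) => [|j _]; last first.
    rewrite scalerA mulfV ?scale1r // pnatr_eq0 -lt0n.
    exact: leq_ltn_trans (ltn_ord i).
  by rewrite (bigD1 i) //= addrAC subrr add0r.
by apply: psd_sum => j _; apply: pr.
Qed.

Section Assignment.
Variables (dS dE m : nat) (rho : nat -> 'M[C]_(dS * dE)) (LP : 'M[C]_dS -> 'M[C]_(dS * dE)).
Hypotheses (m0 : (0 < m)%N) (dE0 : (0 < dE)%N).
Hypothesis dr : forall i, (i < m)%N -> density (rho i).
Hypotheses (lLP : linear LP) (tLP : trace_preserving LP) (pLP : positive_map LP).
Hypothesis LPr : forall i, (i < m)%N -> LP (ptrE (rho i)) = rho i.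

(** [G] and [H] are the square roots of the average state and of its reduction, [Hi] is the
    pseudo-inverse of [H], and [P] its support. [LP] enters as the map undoing [ptrE]. *)
Lemma assignment_structure : exists (G : 'M[C]_(dS * dE)) (H Hi P : 'M[C]_dS),
  [/\ [/\ G^H = G, H^H = H, Hi^H = Hi & P^H = P],
      [/\ H *m Hi = P, Hi *m H = P, P *m P = P, P *m H = H & H *m P = H],
      [/\ P *m Hi = Hi, Hi *m P = Hi, ptrE (G *m G) = H *m H & ext dE P *m G = G],
      forall i, (i < m)%N -> P *m ptrE (rho i) = ptrE (rho i) /\
                             ptrE (rho i) *m P = ptrE (rho i) &
      forall i, (i < m)%N -> G *m ext dE (Hi *m ptrE (rho i) *m Hi) *m G = rho i].
Proof.
have lT := @ptrE_linear R dS dE; have tT := @ptrE_tr R dS dE.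
have pT := @ptrE_positive R dS dE.
have [w ew] : exists w, w = \sum_(j < m) (m%:R)^-1 *: rho j.
  by exists (\sum_(j < m) (m%:R)^-1 *: rho j).
have pw : psd w.
  rewrite ew; apply: psd_sum => j _; apply: psdZ; first by rewrite invr_ge0 ler0n.
  by case: (dr (ltn_ord j)).
have pcw i : (i < m)%N -> psd (m%:R *: w - rho i).
  move=> im; rewrite ew; apply: (psd_average (Ordinal im)) => j jm.
  by case: (dr jm).
have LPw : LP (ptrE w) = w.
  rewrite ew (linear_fsum lT) (linear_fsum lLP); apply: eq_bigr => j _.
  by rewrite (linear_fZ lT) (linear_fZ lLP) LPr.
have [q [qi qW]] := psd_quarter pw.
have [h [hi hW]] := psd_quarter (pT _ pw).
have [hq hqi q1 q2 [q3 q4]] := quarter_rootE qW.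
have [hh hhi h1 h2 [h3 h4]] := quarter_rootE hW.
have [hP PP] := quarter_projE hW.
have [_ _ eW cq _] := qW; have [_ _ eTW ch _] := hW.
have HP : h *m h *m (h *m hi) = h *m h by rewrite -(mulmxA h) h1.
have tG : ptrE (q *m q *m (q *m q)) = h *m h *m (h *m h) by rewrite eW eTW.
exists (q *m q), (h *m h), (hi *m hi), (h *m hi); split.
- by split=> //; rewrite adjmxM ?hq ?hh ?hhi.
- split=> //.
  + by rewrite !mulmxA -(mulmxA _ h hi) -!mulmxA (mulmxA h hi) (mulmxA h (h *m hi)) h1.
  + by rewrite !mulmxA -(mulmxA hi hi h) -ch h3 -ch.
  + by rewrite mulmxA h2.
- split=> //.
  + by rewrite mulmxA h4.
  + by rewrite -(mulmxA hi) h3.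
  (* The complement of [P] has trace 0 against the reduced state, hence its extension has trace 0
     against w and kills the square root of w. *)
  + have [Np eN] : exists Np, Np = 1%:M - h *m hi by exists (1%:M - h *m hi).
    have hN : Np^H = Np by rewrite eN adjmxB adjmx1 hP.
    have HN : h *m h *m Np = 0 by rewrite eN mulmxBr mulmx1 HP subrr.
    have e0 : ext dE Np *m (q *m q) = 0.
      apply: mxtrace_gram_le0; rewrite !adjmxM hq ext_adj hN.
      suff -> : \tr (q *m q *m ext dE Np *m (ext dE Np *m (q *m q))) = 0 by [].
      transitivity (\tr (q *m q *m (q *m q) *m ext dE (Np *m Np))).
        rewrite extM; move: (q *m q) (ext dE Np) => W E.
        by rewrite [LHS]mxtrace_mulC (mulmxA (W *m W)) [RHS]mxtrace_mulC !mulmxA.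
      by rewrite -mxtrace_ptrE_mul tG (mulmxA _ Np) -(mulmxA (h *m h) _ Np) HN mulmx0 mul0mx mxtrace0.
    have -> : h *m hi = 1%:M - Np by rewrite eN opprB addrC subrK.
    rewrite (linear_fB (@ext_linear dS dS dE)) ext1 mulmxBl mul1mx e0 subr0.
    by [].
- move=> i im; have pT' := pT _ (dr im).1.
  have pcT : psd (m%:R *: ptrE w - ptrE (rho i)).
    by rewrite -(linear_fZ lT) -(linear_fB lT); apply/pT/pcw.
  by have [] := quarter_dominated hW pT' pcT.
- move=> i im; have m1 : (0 : C) <= m%:R by rewrite ler0n.
  have := petz_recovery lT tT pT lLP tLP pLP qW hW LPw m1 (dr im).1 (pcw i im) (LPr im).
  by rewrite trdual_ptrE.
Qed.

Lemma assignment_markov : markov_state (omega_ref m rho).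
Proof.
have [G [H [Hi [P [[hG hH hHi hP] [HHi HiH PP PH HP] [PHi HiP tG PG] Ps er]]]]] :=
  assignment_structure.
apply: (markov_of_sufficient hG hH hHi hP HHi HiH PH HP PHi HiP tG PG) => // i im.
have [Ps1 Ps2] := Ps i im.
have [D eD] : exists D, D = Hi *m ptrE (rho i) *m Hi by exists (Hi *m ptrE (rho i) *m Hi).
have sD : sufficient G H Hi P D.
  apply: (sufficient_petz hG hH hHi hP HHi HiH PH HP tG).
  - by rewrite eD !mulmxA PHi.
  - by rewrite eD -!mulmxA HiP.
  - rewrite [in LHS]eD er // eD !mulmxA HHi -!mulmxA HiH.
    by rewrite Ps2 Ps1.
(* The left [G] in [G *m [D]E *m G] moves past [D], which becomes [H *m D *m Hi]. *)
exists (H *m D *m Hi).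
  exact: (sufficient_sharp hG hH hHi hP HHi HiH PH HP PHi tG sD).
rewrite -(er i im) -eD.
by rewrite (sufficient_sharpE hG hH hHi hP HHi HiH PH HP tG sD) -(mulmxA _ G G).
Qed.

Lemma assignment_cp : exists LCP : 'M[C]_dS -> 'M[C]_(dS * dE),
  [/\ linear LCP, trace_preserving LCP, completely_positive LCP &
      forall i, (i < m)%N -> LCP (ptrE (rho i)) = rho i].
Proof.
have [G [H [Hi [P [[hG hH hHi hP] [HHi HiH PP PH HP] [PHi HiP tG PG] Ps er]]]]] :=
  assignment_structure.
have [s [ps es]] := psd_sqrt (dr m0).1.
have [Q eQ] : exists Q, Q = 1%:M - P by exists (1%:M - P).
have hQ : Q^H = Q by rewrite eQ adjmxB adjmx1 hP.
have QQ : Q *m Q = Q by rewrite eQ mulmxBr mulmx1 mulmxBl mul1mx PP subrr subr0.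
(* The Petz term has trace [\tr (P *m Y)]; the second term prepares [rho 0] with the missing trace
   and vanishes on the reduced states, which [P] fixes. *)
exists (fun Y => G *m ext dE (Hi *m Y *m Hi) *m G + \tr (Q *m Y) *: (s *m s)); split.
- move=> a X Y; rewrite mulmxDr mulmxDl -scalemxAr -scalemxAl extD extZ.
  rewrite mulmxDr mulmxDl -scalemxAr -scalemxAl.
  rewrite (mulmxDr Q) -(scalemxAr a Q) mxtraceD mxtraceZ scalerDl -scalerA.
  by rewrite scalerDr addrACA.
- move=> X; rewrite mxtraceD mxtraceZ es (dr m0).2 mulr1.
  have -> : \tr (G *m ext dE (Hi *m X *m Hi) *m G) = \tr (P *m X).
    rewrite mxtrace_mulC mulmxA -mxtrace_ptrE_mul tG !mulmxA -(mulmxA H H Hi) HHi HP.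
    by rewrite mxtrace_mulC !mulmxA HiH.
  by rewrite -mxtraceD -mulmxDl eQ addrC subrK mul1mx.
- apply: completely_positiveD; last exact: prepare_completely_positive (psd_adj ps).
  have c1 := @conj_completely_positive R _ _ Hi.
  have c2 := @tens1_completely_positive R dS dE.
  have c3 := @conj_completely_positive R _ _ G.
  have := completely_positive_comp (completely_positive_comp c1 c2) c3.
  by rewrite hHi hG.
- move=> i im; rewrite er //; have [Ps1 _] := Ps i im.
  by rewrite eQ mulmxBl mul1mx Ps1 subrr mxtrace0 scale0r addr0.
Qed.

End Assignment.
End Assembly.

(** * Markov structure and complete positivity from a positive assignment *)

Theorem theorem4p1 (R : realType) (dS dE : nat)
  (S : 'M[R[i]]_(dS * dE) -> Prop)
  (M m : nat) (rho : nat -> 'M[R[i]]_(dS * dE))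
  (LP : 'M[R[i]]_dS -> 'M[R[i]]_(dS * dE)) :
  (* S is a nonempty set of density operators on H_S (x) H_E *)
  (exists X, S X) ->
  (forall X, S X -> density X) ->
  (* S' = {rho 0, ..., rho (M-1)} is a maximal linearly independent subset of S *)
  (forall i, (i < M)%N -> S (rho i)) ->
  free [seq rho i | i <- iota 0 M] ->
  (forall X, S X -> ~ free (X :: [seq rho i | i <- iota 0 M])) ->
  (* the first m reduced states are linearly independent and span V_S = Tr_E V *)
  (m <= M)%N ->
  free [seq ptrE (rho i) | i <- iota 0 m] ->
  (forall Y, ptrE_set (inSpanSet S) Y <->
             Y \in <<[seq ptrE (rho i) | i <- iota 0 m]>>%VS) ->
  (* a linear, trace-preserving, positive assignment map Lambda^(P) *)
  linear LP -> trace_preserving LP -> positive_map LP ->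
  (forall i, (i < m)%N -> LP (ptrE (rho i)) = rho i) ->
  (* (i) *)
  markov_state (omega_ref m rho)
  (* (ii) *)
  /\ (exists LCP : 'M[R[i]]_dS -> 'M[R[i]]_(dS * dE),
        [/\ linear LCP, trace_preserving LCP, completely_positive LCP &
            forall i, (i < m)%N -> LCP (ptrE (rho i)) = rho i])
  (* (iii) *)
  /\ (forall Y : 'M[R[i]]_dS,
        ptrE_set (fun X => density X /\ inSpanSet S X) Y <->
        (density Y /\ ptrE_set (inSpanSet S) Y))
  /\ (forall LCP : 'M[R[i]]_dS -> 'M[R[i]]_(dS * dE),
        linear LCP -> trace_preserving LCP -> completely_positive LCP ->
        (forall i, (i < m)%N -> LCP (ptrE (rho i)) = rho i) ->
        forall U : 'M[R[i]]_(dS * dE),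
          unitary U -> U_consistent (inSpanSet S) U ->
          completely_positive (fun Z => ptrE (U *m LCP Z *m adjmx U))
          /\ (forall rhoSE, density rhoSE -> inSpanSet S rhoSE ->
                ptrE (U *m LCP (ptrE rhoSE) *m adjmx U)
                = ptrE (U *m rhoSE *m adjmx U))).
Proof.
move=> [X0 SX0] Sd Sr _ _ mM _ VS lLP tLP pLP LPr.
have span0 : inSpanSet S X0.
  exists [:: X0]; split; last by apply: memv_span; rewrite inE.
  by move=> Y; rewrite inE => /eqP->.
have tr0 : \tr X0 != 0 by rewrite (Sd _ SX0).2 oner_eq0.
(* With [m = 0] the reduction of a state would lie in the span of the empty list, contradicting
   trace 1. *)
have m0 : (0 < m)%N.
  rewrite lt0n; apply/eqP=> em; have : ptrE_set (inSpanSet S) (ptrE X0) by exists X0.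
  move/VS; rewrite em /= span_nil memv0 => /eqP e0.
  by move: tr0; rewrite -ptrE_tr e0 mxtrace0 eqxx.
have dE0 : (0 < dE)%N.
  rewrite lt0n; apply/eqP=> eE; move: tr0; rewrite -ptrE_tr /mxtrace big1 ?eqxx //.
  move=> i _; rewrite mxE big1 // => e _.
  by have := ltn_ord e; rewrite [X in (_ < X)%N]eE.
have Srm i : (i < m)%N -> S (rho i) by move=> im; apply/Sr/(leq_trans im).
have dr i : (i < m)%N -> density (rho i) by move/Srm/Sd.
(* On the span of the reduced states, any linear map with the prescribed values is a right inverse
   of [ptrE] with values in the span of [S]; this serves both [LP] and [LCP]. *)
have assign (f : 'M[R[i]]_dS -> 'M[R[i]]_(dS * dE)) Y : linear f ->
    (forall i, (i < m)%N -> f (ptrE (rho i)) = rho i) ->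
    ptrE_set (inSpanSet S) Y -> inSpanSet S (f Y) /\ ptrE (f Y) = Y.
  move=> lf fr /VS Ys.
  have [c [eY ->]] := span_combination lf fr Ys.
  split; first exact: inSpanSet_combination.
  rewrite (linear_fsum (@ptrE_linear R dS dE)) eY; apply: eq_bigr => i _.
  by rewrite (linear_fZ (@ptrE_linear R dS dE)).
split; first exact: (assignment_markov m0 dE0 dr lLP tLP pLP LPr).
split; first exact: (assignment_cp m0 dr lLP tLP pLP LPr).
split=> [Y|LCP lC tC cC Cr U _ Ucons]; first split.
- move=> [X [[[pX tX] SX] ->]]; split; last by exists X.
  by split; [apply: ptrE_positive | rewrite ptrE_tr].
(* Positivity and trace preservation of [LP] make [LP Y] a density matrix lifting [Y]. *)
- move=> [[pY tY] SY]; have [SX eX] := assign LP Y lLP LPr SY.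
  by exists (LP Y); split=> //; split=> //; split; [apply: pLP | rewrite tLP].
split.
  have c2 := @conj_completely_positive R _ _ U.
  have c3 := @ptrE_completely_positive R dS dE.
  exact: (completely_positive_comp (completely_positive_comp cC c2) c3).
move=> rhoSE _ SE.
have SY : ptrE_set (inSpanSet S) (ptrE rhoSE) by exists rhoSE.
have [SX eX] := assign LCP (ptrE rhoSE) lC Cr SY.
(* The reassigned state and the original one lie in the span and share a reduction, which is the
   situation of [U_consistent]. *)
exact: Ucons.
Qed.
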